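(* Let $A,B\in \mathrm{PSL}(2,\mathbb{R})$ be such that $\langle A,B\rangle$ is a free Fuchsian group of rank 2. Let $m,n\in\mathbb{N}_+$ and let $R,S\in\mathrm{PSL}(2,\mathbb{R})$ with $R^m=A$ and $S^n=B$. Let $(x,y,z)=(\mathrm{tr}(R),\mathrm{tr}(S),\mathrm{tr}(RS))$ be the trace triple of $(R,S)$. Then the group $\langle R,S\rangle$ is discrete and free of rank 2 if and only if one of the following two cases occurs. Case F1: $\mathrm{tr}([A,B])\le -2$ and $S_m(x)^2\cdot S_n(y)^2\le \frac12-\frac14\,\mathrm{tr}([A,B])$. Case F2: $\mathrm{tr}([A,B])>2$ and the trace triple $(x',y',z')$ which results from applying the Trace Minimization Algorithm to $(x,y,z)$ satisfies $x'\ge 2$, $y'\ge 2$, and $z'\le -2$.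
   Context: $\mathrm{PSL}(2,\mathbb{R})=\mathrm{SL}(2,\mathbb{R})/\{\pm I_2\}$. A subgroup is discrete if it contains no convergent sequence of pairwise distinct elements; it is elementary if the commutator of any two of its elements of infinite order has trace $2$. A Fuchsian group is a non-elementary discrete subgroup of $\mathrm{PSL}(2,\mathbb{R})$. Here $[A,B]=ABA^{-1}B^{-1}$, whose trace is well defined. Trace convention: each of $A,B,R,S$ is represented by a matrix in $\mathrm{SL}(2,\mathbb{R})$ with non-negative trace; the trace of a word in $A,B$ (resp. $R,S$) is the trace of the corresponding word in these representatives. Chebyshev S-polynomials: $S_0(t)=0$, $S_1(t)=1$, $S_i(t)=t\,S_{i-1}(t)-S_{i-2}(t)$ for $i\ge 2$. Trace Minimization Algorithm. Input: a trace triple $(a,b,c)=(\mathrm{tr}(A),\mathrm{tr}(B),\mathrm{tr}(AB))$ of a pair of elements of $\mathrm{PSL}(2,\mathbb{R})$ with $\tau=a^2+b^2+c^2-abc-2\neq 2$ (this $\tau$ is the trace of the commutator). (1) Permute the triple and, if necessary, switch two of the three signs (change of representatives) to get $(x,y,z)$ with $2<x\le y\le|z|$ if $\tau<2$, and $0\le x\le y\le |z|$ if $\tau>2$. (2) As long as the stopping condition ''$z\le \frac12 xy$ (if $\tau<2$)'', resp. ''an entry of the triple is negative (if $\tau>2$)'' does not hold, replace $(x,y,z)$ by the numbers $x,y,xy-z$ arranged in increasing order. (3) If $\tau<2$, return the triple in increasing order. If $\tau>2$, return the triple consisting of the two non-negative entries in increasing order followed by the negative entry. *)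

(* Defs.v *)
From HB Require Import structures.
From mathcomp Require Import all_boot all_order all_algebra.
From mathcomp Require Import generic_quotient.
From mathcomp Require Import all_classical all_reals all_analysis.

Set Implicit Arguments.
Unset Strict Implicit.
Unset Printing Implicit Defensive.

Import Order.TTheory GRing.Theory Num.Theory.
Import numFieldNormedType.Exports.

Local Open Scope classical_set_scope.
Local Open Scope ring_scope.
Local Open Scope quotient_scope.

Section Groups.
Variable G : groupType.

Definition is_subgroup (H : set G) : Prop :=
  [/\ H 1%g, (forall g h, H g -> H h -> H (g * h)%g)
    & (forall g, H g -> H (g^-1)%g)].

Definition generated (X : set G) : set G := smallest is_subgroup X.

Definition infinite_order (g : G) : Prop :=
  forall k : nat, (0 < k)%N -> (g ^+ k)%g <> 1%g.

Definition commutator (g h : G) : G := (g * h * g^-1 * h^-1)%g.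

(* A letter (i, b) stands for the i-th generator if b = false and for its
   inverse if b = true. *)
Definition eval_word (k : nat) (e : 'I_k -> G) (w : seq ('I_k * bool)) : G :=
  (\prod_(l <- w) (if l.2 then (e l.1)^-1 else e l.1))%g.

Definition reduced (k : nat) (w : seq ('I_k * bool)) : bool :=
  sorted (fun l l' => ~~ ((l.1 == l'.1) && (l.2 != l'.2))) w.

Definition free_family (k : nat) (e : 'I_k -> G) : Prop :=
  forall w, reduced w -> w <> [::] -> eval_word e w <> 1%g.

Definition free_of_rank (k : nat) (H : set G) : Prop :=
  exists e : 'I_k -> G, H = generated (range e) /\ free_family e.

End Groups.

Section SL2.
Variable K : realType.

Record SL2 := MkSL2 { mxSL2 :> 'M[K]_2; _ : \det mxSL2 == 1 }.

HB.instance Definition _ := [isSub for mxSL2].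
HB.instance Definition _ := [Choice of SL2 by <:].
HB.instance Definition _ :=
  Topological.copy SL2 (initial_topology (mxSL2 : SL2 -> 'M[K]_2)).

Lemma det_SL2 (g : SL2) : \det g = 1.
Proof. by case: g => g /= /eqP. Qed.

Fact SL2_one_subproof : \det (1%:M : 'M[K]_2) == 1.
Proof. by rewrite det1. Qed.
Fact SL2_mul_subproof (g h : SL2) : \det (g *m h) == 1.
Proof. by rewrite det_mulmx !det_SL2 mulr1. Qed.
Fact SL2_inv_subproof (g : SL2) : \det (invmx g) == 1.
Proof. by rewrite det_inv det_SL2 invr1. Qed.
Fact SL2_opp_subproof (g : SL2) : \det (- (g : 'M[K]_2)) == 1.
Proof. by rewrite -scaleN1r detZ det_SL2 mulr1 sqrrN expr1n. Qed.

Definition SL2_one := MkSL2 SL2_one_subproof.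
Definition SL2_mul g h := MkSL2 (SL2_mul_subproof g h).
Definition SL2_inv g := MkSL2 (SL2_inv_subproof g).
Definition SL2_opp g := MkSL2 (SL2_opp_subproof g).

Fact SL2_mulA : associative SL2_mul.
Proof. by move=> f g h; apply: val_inj; exact: mulmxA. Qed.
Fact SL2_mul1 : left_id SL2_one SL2_mul.
Proof. by move=> g; apply: val_inj; exact: mul1mx. Qed.
Fact SL2_mulr1 : right_id SL2_one SL2_mul.
Proof. by move=> g; apply: val_inj; exact: mulmx1. Qed.
Fact SL2_mulV : left_inverse SL2_one SL2_inv SL2_mul.
Proof.
by move=> g; apply: val_inj; apply: mulVmx; rewrite unitmxE det_SL2 unitr1.
Qed.
Fact SL2_mulrV : right_inverse SL2_one SL2_inv SL2_mul.
Proof.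
by move=> g; apply: val_inj; apply: mulmxV; rewrite unitmxE det_SL2 unitr1.
Qed.

HB.instance Definition _ :=
  isGroup.Build SL2 SL2_mulA SL2_mul1 SL2_mulr1 SL2_mulV SL2_mulrV.

Definition PSL2_rel : rel SL2 := fun g h => (g == h) || (g == SL2_opp h).

Lemma SL2_oppK : involutive SL2_opp.
Proof. by move=> g; apply: val_inj; exact: opprK. Qed.
Lemma SL2_mulNr (g h : SL2) : SL2_mul g (SL2_opp h) = SL2_opp (SL2_mul g h).
Proof. by apply: val_inj; exact: mulmxN. Qed.
Lemma SL2_mulNl (g h : SL2) : SL2_mul (SL2_opp g) h = SL2_opp (SL2_mul g h).
Proof. by apply: val_inj; exact: mulNmx. Qed.
Lemma SL2_invN (g : SL2) : SL2_inv (SL2_opp g) = SL2_opp (SL2_inv g).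
Proof.
apply: (@mulgI SL2 (SL2_opp g)).
change (SL2_mul (SL2_opp g) (SL2_inv (SL2_opp g)) =
        SL2_mul (SL2_opp g) (SL2_opp (SL2_inv g))).
by rewrite SL2_mulrV SL2_mulNl SL2_mulNr SL2_oppK SL2_mulrV.
Qed.

Fact PSL2_rel_refl : reflexive PSL2_rel.
Proof. by move=> g; rewrite /PSL2_rel eqxx. Qed.
Fact PSL2_rel_sym : symmetric PSL2_rel.
Proof.
move=> g h; rewrite /PSL2_rel (eq_sym g h).
by congr orb; apply/eqP/eqP => ->; rewrite SL2_oppK.
Qed.
Fact PSL2_rel_trans : transitive PSL2_rel.
Proof.
move=> g f h /orP[/eqP-> //|/eqP->] /orP[/eqP->|/eqP->];
by rewrite /PSL2_rel ?SL2_oppK eqxx ?orbT.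
Qed.

Canonical PSL2_equiv :=
  EquivRel PSL2_rel PSL2_rel_refl PSL2_rel_sym PSL2_rel_trans.

Definition PSL2 := quotient_topology {eq_quot PSL2_equiv}.

HB.instance Definition _ := Topological.on PSL2.
HB.instance Definition _ := Quotient.on PSL2.

Lemma PSL2_eqP (g h : SL2) :
  reflect (\pi_PSL2 g = \pi_PSL2 h) (PSL2_rel g h).
Proof.
apply: (iffP idP) => [gh|gh].
- by apply: (elimT (@eqmodP _ PSL2_equiv g h)).
- by apply: (introT (@eqmodP _ PSL2_equiv g h)).
Qed.

Definition PSL2_one : PSL2 := \pi_PSL2 1%g.
Definition PSL2_mul (P Q : PSL2) : PSL2 := \pi_PSL2 (repr P * repr Q)%g.
Definition PSL2_inv (P : PSL2) : PSL2 := \pi_PSL2 (repr P)^-1%g.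

Lemma PSL2_reprP (g : SL2) :
  repr (\pi_PSL2 g) = g \/ repr (\pi_PSL2 g) = SL2_opp g.
Proof.
have /PSL2_eqP/orP[/eqP|/eqP] : \pi_PSL2 (repr (\pi_PSL2 g)) = \pi_PSL2 g.
- by rewrite reprK.
- by left.
- by right.
Qed.

Lemma PSL2_piN (g : SL2) : \pi_PSL2 (SL2_opp g) = \pi_PSL2 g.
Proof. by apply/PSL2_eqP; rewrite /PSL2_rel eqxx orbT. Qed.

Lemma PSL2_piM (g h : SL2) :
  PSL2_mul (\pi_PSL2 g) (\pi_PSL2 h) = \pi_PSL2 (g * h)%g.
Proof.
rewrite /PSL2_mul.
have mulgN (f k : SL2) : (f * SL2_opp k)%g = SL2_opp (f * k)%g.
  exact: SL2_mulNr.
have mulNg (f k : SL2) : (SL2_opp f * k)%g = SL2_opp (f * k)%g.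
  exact: SL2_mulNl.
by case: (PSL2_reprP g) => ->; case: (PSL2_reprP h) => ->;
  rewrite ?mulNg ?mulgN ?PSL2_piN.
Qed.

Lemma PSL2_piV (g : SL2) : PSL2_inv (\pi_PSL2 g) = \pi_PSL2 (g^-1)%g.
Proof.
rewrite /PSL2_inv; case: (PSL2_reprP g) => -> //.
have -> : ((SL2_opp g)^-1)%g = SL2_opp (g^-1)%g by exact: SL2_invN.
by rewrite PSL2_piN.
Qed.

Lemma PSL2_piP (P : PSL2) : exists g : SL2, P = \pi_PSL2 g.
Proof. by exists (repr P); rewrite reprK. Qed.

Fact PSL2_mulA : associative PSL2_mul.
Proof.
move=> P Q S; have [p ->] := PSL2_piP P; have [q ->] := PSL2_piP Q.
have [s ->] := PSL2_piP S.
by rewrite (PSL2_piM q) (PSL2_piM p) (PSL2_piM p q) (PSL2_piM (p * q)%g) mulgA.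
Qed.
Fact PSL2_mul1 : left_id PSL2_one PSL2_mul.
Proof.
by move=> P; have [p ->] := PSL2_piP P; rewrite (PSL2_piM 1%g p) mul1g.
Qed.
Fact PSL2_mulr1 : right_id PSL2_one PSL2_mul.
Proof.
by move=> P; have [p ->] := PSL2_piP P; rewrite (PSL2_piM p 1%g) mulg1.
Qed.
Fact PSL2_mulV : left_inverse PSL2_one PSL2_inv PSL2_mul.
Proof.
move=> P; have [p ->] := PSL2_piP P.
by rewrite (PSL2_piV p) (PSL2_piM p^-1%g p) mulVg.
Qed.
Fact PSL2_mulrV : right_inverse PSL2_one PSL2_inv PSL2_mul.
Proof.
move=> P; have [p ->] := PSL2_piP P.
by rewrite (PSL2_piV p) (PSL2_piM p p^-1%g) mulgV.
Qed.

HB.instance Definition _ :=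
  isGroup.Build PSL2 PSL2_mulA PSL2_mul1 PSL2_mulr1 PSL2_mulV PSL2_mulrV.

(* A representative with non-negative trace; it is unique unless the trace
   is 0, in which case one of the two representatives is selected. *)
Definition nnlift (P : PSL2) : SL2 :=
  if 0 <= \tr (repr P) then repr P else SL2_opp (repr P).

Lemma nnlift_trace_ge0 (P : PSL2) : 0 <= \tr (nnlift P).
Proof.
rewrite /nnlift; case: ifPn => // /negbTE; rewrite real_leNgt ?num_real//.
by move=> /negbFE /ltW; rewrite -oppr_ge0 -[X in 0 <= X]raddfN.
Qed.

Lemma nnliftK (P : PSL2) : \pi_PSL2 (nnlift P) = P.
Proof. by rewrite /nnlift; case: ifP => _; rewrite ?PSL2_piN reprK. Qed.

Definition commutator_trace (P Q : PSL2) : K :=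
  \tr (commutator (nnlift P) (nnlift Q)).

Definition is_discrete (H : set PSL2) : Prop :=
  ~ exists u : nat -> PSL2,
      [/\ injective u, forall i, H (u i) & exists l : PSL2, u @ \oo --> l].

Definition elementary (H : set PSL2) : Prop :=
  forall P Q, H P -> H Q -> infinite_order P -> infinite_order Q ->
    commutator_trace P Q = 2.

Definition Fuchsian (H : set PSL2) : Prop :=
  [/\ is_subgroup H, is_discrete H & ~ elementary H].

End SL2.

Fixpoint chebyshevS (K : realType) (i : nat) : {poly K} :=
  match i with
  | 0 => 0
  | j.+1 => match j with
            | 0 => 1
            | k.+1 => 'X * chebyshevS K j - chebyshevS K k
            end
  end.

Section TraceMinimization.
Variable K : realType.

Definition triple : Type := (K * K * K)%type.

Implicit Types t u v : triple.

Definition tau t : K :=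
  let: (a, b, c) := t in a ^+ 2 + b ^+ 2 + c ^+ 2 - a * b * c - 2.

Definition entries t : seq K := let: (a, b, c) := t in [:: a; b; c].

Definition permuted t u : bool := perm_eq (entries t) (entries u).

Definition increasing t : bool := sorted <=%R (entries t).

Definition sign_switched t u : bool :=
  let: (a, b, c) := t in
  u \in [:: (a, b, c); (- a, - b, c); (- a, b, - c); (a, - b, - c)].

Definition tma_start t u : Prop :=
  (exists2 s, permuted t s & sign_switched s u) /\
  let: (x, y, z) := u in
  if tau t < 2 then [&& 2 < x, x <= y & y <= `|z|]
  else [&& 0 <= x, x <= y & y <= `|z|].

(* The value T of tau is unchanged by all the operations of the algorithm; it
   is passed along in order to select between the two variants. *)
Definition tma_stop (T : K) u : bool :=
  let: (x, y, z) := u in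
  if T < 2 then z <= x * y / 2 else [|| x < 0, y < 0 | z < 0].

Definition tma_step u v : bool :=
  let: (x, y, z) := u in permuted (x, y, x * y - z) v && increasing v.

Inductive tma_loop (T : K) : triple -> triple -> Prop :=
| TmaStop u : tma_stop T u -> tma_loop T u u
| TmaStep u v w :
    ~~ tma_stop T u -> tma_step u v -> tma_loop T v w -> tma_loop T u w.

Definition tma_return (T : K) u v : bool :=
  permuted u v &&
  let: (x, y, z) := v in
  if T < 2 then increasing v else [&& 0 <= x, x <= y & z < 0].

(* tma t v: on the input t, the algorithm terminates and returns v. *)
Definition tma t v : Prop :=
  tau t <> 2 /\
  exists u w, [/\ tma_start t u, tma_loop (tau t) u w
                & tma_return (tau t) w v].

End TraceMinimization.

(* Traces of words are computed on the representatives with non-negative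
   trace, so that the third entry may be negative. *)
Definition trace_triple (K : realType) (P Q : PSL2 K) : triple K :=
  (\tr (nnlift P), \tr (nnlift Q), \tr (nnlift P * nnlift Q)%g).

(* Main.v *)
(** Put T = tr [R,S].  Since det (XY - YX) = 2 - tr [X,Y] and
    R^m = S_m(x) R - S_{m-1}(x) I, one has
    tr [A,B] - 2 = S_m(x)^2 S_n(y)^2 (T - 2), and this is nonzero because <A,B>
    is non-elementary; hence case F1 says T <= -2 and case F2 starts from T > 2.

    Necessity: a free group is torsion-free and the powers of an elliptic
    element of infinite order accumulate, so every element of <R,S> has
    |trace| >= 2.  This excludes -2 < T < 2; when T > 2, all triples met by the
    algorithm are traces of generating pairs, and each step lowers their sum by
    at least a constant, so it stops at a triple of the required form.

    Sufficiency: write R = r1 r2 and S = r2 r3 with traceless r_i, where r2 is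
    the normalized commutator RS - SR.  In case F1 the r_i are half-turns and
    r1 r2 r3 has a real eigenvector, whose successive images under r3 and r2 are
    the vertices of an ideal triangle; in case F2 (for the final pair) they are
    reflections in disjoint geodesics.  Either way r1, r2, r3 exchange three
    disjoint intervals of the projective line with their complements, and
    ping-pong gives freeness and discreteness. *)
Require Import Defs.
From HB Require Import structures.
From mathcomp Require Import all_boot all_order all_algebra.
From mathcomp Require Import generic_quotient.
From mathcomp Require Import all_classical all_reals all_analysis.
From mathcomp Require Import ring lra.

Set Implicit Arguments.
Unset Strict Implicit.
Unset Printing Implicit Defensive.

Import Order.TTheory GRing.Theory Num.Theory.
Import numFieldNormedType.Exports.

Local Open Scope classical_set_scope.
Local Open Scope ring_scope.
Local Open Scope quotient_scope.

(** * Words in a free group *)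

Section Words.
Variable G : groupType.
Implicit Types (g h : G) (X H : set G).

Lemma generated_subgroup X : is_subgroup (generated X).
Proof.
split=> [H [[]]//|g h Xg Xh H HX|g Xg H HX]; have [[H1 HM HV] _] := HX.
- by apply: HM; [exact: Xg|exact: Xh].
- by apply: HV; exact: Xg.
Qed.

Lemma sub_generated X : X `<=` generated X.
Proof. by move=> g Xg H [_]; exact. Qed.

Lemma generated_sub X H : is_subgroup H -> X `<=` H -> generated X `<=` H.
Proof. by move=> sH XH g; apply. Qed.

Lemma generated_eq X Y :
  X `<=` generated Y -> Y `<=` generated X -> generated X = generated Y.
Proof.
by move=> XY YX; apply/seteqP; split; apply: generated_sub => //;
  exact: generated_subgroup.
Qed.

Lemma subgroup_expg H g n : is_subgroup H -> H g -> H (g ^+ n)%g.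
Proof.
by move=> [H1 HM _] Hg; elim: n => [|n IHn]; rewrite ?expg0 // expgS; apply: HM.
Qed.

Lemma generated2_eq (a b a' b' : G) :
  generated [set a; b] a' -> generated [set a; b] b' ->
  generated [set a'; b'] a -> generated [set a'; b'] b ->
  generated [set a; b] = generated [set a'; b'].
Proof. by move=> *; apply: generated_eq => g [->|->]. Qed.

Lemma generated_mem1 (a b : G) : generated [set a; b] a.
Proof. by apply: sub_generated; left. Qed.

Lemma generated_mem2 (a b : G) : generated [set a; b] b.
Proof. by apply: sub_generated; right. Qed.

Variable k : nat.
Implicit Types (l : 'I_k * bool) (w : seq ('I_k * bool)) (e : 'I_k -> G).

Definition cancelling l l' := (l.1 == l'.1) && (l.2 != l'.2).
Definition inv_letter l := (l.1, ~~ l.2).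
Definition letter e l := (if l.2 then (e l.1)^-1 else e l.1)%g.

Lemma cancellingP l l' : cancelling l l' = (l' == inv_letter l).
Proof.
case: l l' => [i b] [j c]; rewrite /cancelling /inv_letter /= xpair_eqE.
by rewrite eq_sym; congr (_ && _); case: b c => [] [].
Qed.

Lemma letter_inv e l : letter e (inv_letter l) = ((letter e l)^-1)%g.
Proof. by case: l => [i []] //=; rewrite /letter /= invgK. Qed.

Lemma eval_nil e : eval_word e [::] = 1%g.
Proof. by rewrite /eval_word big_nil. Qed.

Lemma eval_cons e l w : eval_word e (l :: w) = (letter e l * eval_word e w)%g.
Proof. by rewrite /eval_word big_cons. Qed.

Lemma eval_cat e w w' :
  eval_word e (w ++ w') = (eval_word e w * eval_word e w')%g.
Proof. by rewrite /eval_word big_cat. Qed.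

Lemma eval_rcons e w l :
  eval_word e (rcons w l) = (eval_word e w * letter e l)%g.
Proof. by rewrite -cats1 eval_cat eval_cons eval_nil mulg1. Qed.

Lemma eval_inv e w : exists w', eval_word e w' = ((eval_word e w)^-1)%g.
Proof.
elim: w => [|l w [w' ew']]; first by exists [::]; rewrite eval_nil invg1.
exists (rcons w' (inv_letter l)).
by rewrite eval_rcons eval_cons invgM ew' letter_inv.
Qed.

Lemma generated_eval e g :
  generated (range e) g -> exists w, eval_word e w = g.
Proof.
apply: (@generated_sub _ [set g | exists w, eval_word e w = g]) => [|_ [i _ <-]].
  split=> [|_ _ [w <-] [w' <-]|_ [w <-]]; first by exists [::]; rewrite eval_nil.
  - by exists (w ++ w'); rewrite eval_cat.
  - exact: eval_inv.
by exists [:: (i, false)]; rewrite eval_cons eval_nil mulg1.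
Qed.

Lemma reduced_cons2 l l' w :
  reduced [:: l, l' & w] = ~~ cancelling l l' && reduced (l' :: w).
Proof. by []. Qed.

Lemma reduction e w : ~~ reduced w ->
  exists2 w', (size w' < size w)%N & eval_word e w' = eval_word e w.
Proof.
elim: w => [|l [|l' w] IHw] //; rewrite reduced_cons2 negb_and negbK cancellingP.
case/orP=> [/eqP->|/IHw[w' sw' ew']]; last first.
  by exists (l :: w'); rewrite // !eval_cons ew' eval_cons.
by exists w; rewrite ?ltnS ?leqnSn // !eval_cons letter_inv mulgA mulgV mul1g.
Qed.

Lemma reduced_exists e w : exists2 w', reduced w' & eval_word e w' = eval_word e w.
Proof.
have [n] := ubnP (size w); elim: n w => // n IHn w; rewrite ltnS => wn.
have [rw|/(reduction e)[w' ww' <-]] := boolP (reduced w); first by exists w.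
by apply: IHn; exact: leq_trans ww' wn.
Qed.

(** The cyclic condition also excludes a cancellation at the seam between two consecutive copies of
    [w]. *)
Lemma reduced_nseq w n :
  cycle (fun l l' => ~~ cancelling l l') w -> reduced (flatten (nseq n w)).
Proof.
case: w => [|l w]; first by elim: n.
rewrite /= rcons_path => /andP[lw wl].
suff: path (fun l l' => ~~ cancelling l l') (last l w) (flatten (nseq n (l :: w))).
  by rewrite /reduced; case: flatten => //= a s /andP[].
elim: n => //= n IHn; rewrite wl cat_path lw /=; exact: IHn.
Qed.

Lemma eval_nseq e w n :
  eval_word e (flatten (nseq n w)) = ((eval_word e w) ^+ n)%g.
Proof.
by elim: n => [|n IHn]; rewrite ?expg0 ?eval_nil // expgS /= eval_cat IHn.
Qed.

(* A word of minimal length representing a conjugate of g is cyclically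
   reduced, so its powers are reduced words. *)
Lemma free_torsion_free e g :
  free_family e -> generated (range e) g -> g <> 1%g -> infinite_order g.
Proof.
move=> fe /generated_eval[w0 ew0] g1 n n_gt0 gn1.
have wP : exists s, `[< exists2 w, size w = s &
    exists h, eval_word e w = (h^-1 * g * h)%g >].
  exists (size w0); apply/asboolP; exists w0 => //.
  by exists 1%g; rewrite invg1 mul1g mulg1.
case: (ex_minnP wP) => s /asboolP[w sw [h ew]] min_s.
have {}min_s w' h' : eval_word e w' = (h'^-1 * g * h')%g -> (size w <= size w')%N.
  by move=> ew'; rewrite sw; apply/min_s/asboolP; exists w' => //; exists h'.
have w_nil : w <> [::].
  move=> w0E; apply: g1; rewrite w0E eval_nil in ew.
  have <- : (h * (h^-1 * g * h) * h^-1 = g)%g by rewrite !mulgA mulgV mul1g mulgK.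
  by rewrite -ew mulg1 mulgV.
have rw : reduced w.
  apply/negPn/negP => /(reduction e)[w' ww' ew'].
  by have := min_s w' h; rewrite ew' => /(_ ew); rewrite leqNgt ww'.
suff /reduced_nseq-/(_ n) : cycle (fun l l' => ~~ cancelling l l') w.
  move=> /fe; apply.
    by case: n {gn1} n_gt0 w_nil {ew min_s sw rw} => // n _; case: w.
  rewrite eval_nseq ew.
  suff -> : ((h^-1 * g * h) ^+ n = h^-1 * g ^+ n * h)%g.
    by rewrite gn1 mulg1 mulVg.
  elim: n {n_gt0 gn1} => [|n IHn]; first by rewrite !expg0 mulg1 mulVg.
  by rewrite !expgS IHn !mulgA mulgK.
case: w => [//|l w] in sw ew min_s rw w_nil *.
rewrite /= rcons_path; apply/andP; split; first exact: rw.
apply/negP; case: (lastP w) => [|w' l'] in sw ew min_s rw w_nil *.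
  by rewrite cancellingP /=; case: (l) => i []; rewrite xpair_eqE andbF.
rewrite last_rcons cancellingP => /eqP lE.
(* If the last letter cancels the first, conjugation by the first letter [l] removes both and
   represents a conjugate by the shorter word [w']. *)
have := min_s w' (h * letter e l)%g; rewrite /= size_rcons ltnNge leqnSn => /(_ _)/negP.
apply => //.
have -> : eval_word e w' =
    ((letter e l)^-1 * (letter e l * eval_word e (rcons w' l')) * letter e l)%g.
  by rewrite mulKg eval_rcons lE letter_inv mulgK.
by rewrite -eval_cons ew invgM !mulgA.
Qed.
End Words.

(** * Two-by-two matrices *)

Section Mx22.
Variable K : comNzRingType.
Implicit Types A B : 'M[K]_2.

Lemma mulmx22E m n (A : 'M[K]_(m, 2)) (B : 'M[K]_(2, n)) i j :
  (A *m B) i j = A i 0 * B 0 j + A i 1 * B 1 j.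
Proof.
rewrite mxE !big_ord_recl big_ord0 addr0.
by rewrite (_ : lift ord0 ord0 = 1) //; apply: val_inj.
Qed.

Lemma mxtrace22E A : \tr A = A 0 0 + A 1 1.
Proof.
rewrite /mxtrace !big_ord_recl big_ord0 addr0.
by rewrite (_ : lift ord0 ord0 = 1) //; apply: val_inj.
Qed.

Lemma ord2P (i : 'I_2) : i = 0 \/ i = 1.
Proof. by case: i => [[|[|]]] // lti; [left|right]; apply: val_inj. Qed.

Lemma matrix22P A B : A 0 0 = B 0 0 -> A 0 1 = B 0 1 -> A 1 0 = B 1 0 ->
  A 1 1 = B 1 1 -> A = B.
Proof.
by move=> e00 e01 e10 e11; apply/matrixP => i j;
  case: (ord2P i) => ->; case: (ord2P j) => ->.
Qed.

Lemma det_mx22 A : \det A = A 0 0 * A 1 1 - A 0 1 * A 1 0.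
Proof.
have o1 : lift ord0 ord0 = 1 :> 'I_2 by apply: val_inj.
have l10 : lift (1 : 'I_2) 0 = 0 by apply: val_inj.
rewrite (expand_det_row _ 0) !big_ord_recl big_ord0 /cofactor !det_mx11 !mxE.
rewrite !o1 /= l10 (_ : ord0 = 0) //.
by rewrite (_ : (0 + 0 = 0)%N) // (_ : (0 + 1 = 1)%N) //; ring.
Qed.

(** The adjugate: by Cayley-Hamilton it inverts [A] up to the factor [\det A], and its entries are
    polynomial, so that [ring] applies. *)
Definition adj22 A := (\tr A)%:M - A.

Lemma adj22E A : ((adj22 A 0 0 = A 1 1) * (adj22 A 0 1 = - A 0 1) *
  (adj22 A 1 0 = - A 1 0) * (adj22 A 1 1 = A 0 0))%type.
Proof.
by split; [split; [split|]|]; rewrite !mxE mxtrace22E ?mulr1n ?mulr0n; ring.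
Qed.

Definition mx22E := (mulmx22E, mxtrace22E, det_mx22, adj22E).

Lemma mul_adj22 A : A *m adj22 A = (\det A)%:M.
Proof. by apply: matrix22P; rewrite !mx22E !mxE ?mulr1n ?mulr0n; ring. Qed.

Lemma trace_adj22 A B : \tr (A *m adj22 B) = \tr A * \tr B - \tr (A *m B).
Proof. by rewrite !mx22E; ring. Qed.

(** Fricke's commutator identity, made homogeneous by the determinants so that it is a polynomial
    identity in the eight entries. *)
Lemma fricke A B : \tr (A *m B *m adj22 A *m adj22 B) =
  (\tr A) ^+ 2 * \det B + (\tr B) ^+ 2 * \det A + (\tr (A *m B)) ^+ 2
    - \tr A * \tr B * \tr (A *m B) - 2 * \det A * \det B.
Proof. by rewrite !mx22E; ring. Qed.

Lemma det_bracket A B : \det (A *m B - B *m A) =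
  2 * \det A * \det B - \tr (A *m B *m adj22 A *m adj22 B).
Proof. by rewrite !(mx22E, mxE); ring. Qed.

Definition wedge (v w : 'cV[K]_2) := v 0 0 * w 1 0 - v 1 0 * w 0 0.

Lemma wedge_mul A v w : wedge (A *m v) (A *m w) = \det A * wedge v w.
Proof. by rewrite /wedge !mx22E; ring. Qed.

Lemma wedgeZr a v w : wedge v (a *: w) = a * wedge v w.
Proof. by rewrite /wedge !mxE; ring. Qed.

Lemma wedgeDr v w w' : wedge v (w + w') = wedge v w + wedge v w'.
Proof. by rewrite /wedge !mxE; ring. Qed.

(** The three-term Plücker relation; it will provide three numbers of sum zero attached to the
    vertices of an ideal triangle. *)
Lemma wedge_plucker a v0 v1 v2 :
  wedge a v0 * wedge v1 v2 + wedge a v1 * wedge v2 v0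
    + wedge a v2 * wedge v0 v1 = 0.
Proof. by rewrite /wedge; ring. Qed.

(** A quadratic form vanishing exactly on 0 and the eigenvectors of [A]. Its sign depends only on
    the line through [v], so the condition [0 < qform A v] encodes an open subset of the projective
    line. *)
Definition qform A v := wedge v (A *m v).

Lemma qformN A v : qform A (- v) = qform A v.
Proof. by rewrite /qform /wedge !mx22E !mxE; ring. Qed.

End Mx22.

(** * Commutator traces and lifts from PSL2 to SL2 *)

Section SL2Facts.
Variable K : realType.
Implicit Types (g h : SL2 K) (P Q : PSL2 K).

Lemma val_mulg g h : (g * h)%g = g *m h :> 'M[K]_2.
Proof. by []. Qed.

Lemma val_oneg : (1%g : SL2 K) = 1%:M :> 'M[K]_2.
Proof. by []. Qed.

Lemma val_invg g : (g^-1)%g = adj22 g :> 'M[K]_2.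
Proof.
have gV : (g : 'M[K]_2) *m (g^-1)%g = 1%:M by rewrite -val_mulg mulgV.
have := mul_adj22 g; rewrite det_SL2 -gV => /(congr1 (mulmx (g^-1)%g)).
by rewrite !mulmxA -val_mulg mulVg val_oneg !mul1mx.
Qed.

Lemma trace_commutator g h :
  \tr (commutator g h) = tau (\tr g, \tr h, \tr (g * h)%g).
Proof.
by rewrite /commutator !val_mulg !val_invg fricke !det_SL2 /tau !mulr1.
Qed.

Lemma det_bracket_SL2 g h :
  \det ((g : 'M[K]_2) *m h - h *m g) = 2 - \tr (commutator g h).
Proof.
by rewrite det_bracket !det_SL2 !mulr1 /commutator !val_mulg !val_invg.
Qed.

Lemma piM g h : \pi_(PSL2 K) (g * h)%g = (\pi_(PSL2 K) g * \pi_(PSL2 K) h)%g.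
Proof. by rewrite -PSL2_piM. Qed.

Lemma piV g : \pi_(PSL2 K) (g^-1)%g = ((\pi_(PSL2 K) g)^-1)%g.
Proof. by rewrite -PSL2_piV. Qed.

Lemma piX g n : \pi_(PSL2 K) (g ^+ n)%g = (\pi_(PSL2 K) g ^+ n)%g.
Proof. by elim: n => [|n IHn]; rewrite ?expg0 // !expgS piM IHn. Qed.

Lemma pi_comm g h :
  \pi_(PSL2 K) (commutator g h) = commutator (\pi_(PSL2 K) g) (\pi_(PSL2 K) h).
Proof. by rewrite /commutator !piM !piV. Qed.

Lemma pi_eq g h : \pi_(PSL2 K) g = \pi_(PSL2 K) h ->
  (g : 'M[K]_2) = h \/ (g : 'M[K]_2) = - (h : 'M[K]_2).
Proof. by move=> /PSL2_eqP/orP[/eqP->|/eqP->]; [left|right]. Qed.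

(** Another choice of lifts changes the bracket of the two matrices at most by a sign, which its
    determinant does not see. *)
Lemma trace_commutator_lift P Q g h :
  P = \pi_(PSL2 K) g -> Q = \pi_(PSL2 K) h ->
  commutator_trace P Q = \tr (commutator g h).
Proof.
move=> Pg Qh; rewrite /commutator_trace; apply: oppr_inj.
apply: (addrI 2); rewrite -!det_bracket_SL2.
have /pi_eq : \pi_(PSL2 K) (nnlift P) = \pi_(PSL2 K) g by rewrite nnliftK.
have /pi_eq : \pi_(PSL2 K) (nnlift Q) = \pi_(PSL2 K) h by rewrite nnliftK.
by move=> [->|->] [->|->]; rewrite !(mx22E, mxE); ring.
Qed.

End SL2Facts.

(** * Convergence in PSL2 *)

Section Topology.
Variable K : realType.
Implicit Types (g h : SL2 K) (P Q : PSL2 K).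

Lemma coord_SL2_continuous i j : continuous (fun g => (g : 'M[K]_2) i j).
Proof.
move=> g; apply: (@continuous_comp _ _ _ (@mxSL2 K) (fun M : 'M[K]_2 => M i j)).
  exact: (@initial_continuous _ _ (@mxSL2 K)).
exact: coord_continuous.
Qed.

Lemma cvg_SL2 (u : nat -> SL2 K) g :
  (forall i j, (u n : 'M[K]_2) i j @[n --> \oo] --> (g : 'M[K]_2) i j) ->
  u @ \oo --> g.
Proof.
move=> ug A [_ [[B oB <-] Bg] sBA].
have [Q gQ QB] : nbhs (g : 'M[K]_2) B by apply: open_nbhs_nbhs.
have uQ i : \forall n \near \oo, forall j, Q i j ((u n : 'M[K]_2) i j).
  exact: (@filter_forall _ _ (fun j => [set n | Q i j ((u n : 'M[K]_2) i j)])
    _ _ (fun j => ug i j _ (gQ i j))).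
suff : \forall n \near \oo, A (u n) by [].
near=> n; apply: sBA; apply: QB; near: n.
exact: (@filter_forall _ _ (fun i => [set n | forall j, Q i j ((u n : 'M[K]_2) i j)])).
Unshelve. all: by end_near.
Qed.

(** The entries of [repr] may jump by a sign, but a product of two entries is invariant under
    negation and descends to a continuous function on the quotient. *)
Lemma cvg_PSL2_entries (u : nat -> PSL2 K) P : u @ \oo --> P ->
  forall i j i' j',
  (repr (u n) : 'M[K]_2) i j * (repr (u n) : 'M[K]_2) i' j' @[n --> \oo]
    --> (repr P : 'M[K]_2) i j * (repr P : 'M[K]_2) i' j'.
Proof.
move=> uP i j i' j'.
pose f g := (g : 'M[K]_2) i j * (g : 'M[K]_2) i' j'.
suff cf : continuous (f \o repr : PSL2 K -> K).
  exact: (@cvg_comp _ _ _ u (f \o repr) _ _ _ uP (cf P)).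
apply: repr_comp_continuous => [g|g h /eqP/pi_eq gh].
  by apply: cvgM; [exact: (nbhs_filter g)|exact: coord_SL2_continuous..].
by apply/eqP; rewrite /f; case: gh => -> //; rewrite !mxE mulrNN.
Qed.

(** Since [g] preserves [wedge], it can be moved to the other side; then [g] and [h] each enter only
    through products of two of their own entries. *)
Lemma qform_conj g h (M : 'M[K]_2) v :
  qform M ((g^-1 * h)%g *m v) =
    qform ((g : 'M[K]_2) *m M *m adj22 g) ((h : 'M[K]_2) *m v).
Proof.
rewrite /qform -[LHS]mul1r -(det_SL2 g) -wedge_mul.
rewrite val_mulg !mulmxA -val_invg -val_mulg mulgV val_oneg mul1mx.
by rewrite -!mulmxA.
Qed.

Lemma cvg_qform_conj (u : nat -> PSL2 K) P (M : 'M[K]_2) v : u @ \oo --> P ->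
  qform M (((repr (u n))^-1 * repr (u n.+1))%g *m v) @[n --> \oo] --> qform M v.
Proof.
move=> uP; have uE := cvg_PSL2_entries uP.
have u'E i j i' j' :
  (repr (u n.+1) : 'M[K]_2) i j * (repr (u n.+1) : 'M[K]_2) i' j' @[n --> \oo]
    --> (repr P : 'M[K]_2) i j * (repr P : 'M[K]_2) i' j'.
  pose s n := (repr (u n) : 'M[K]_2) i j * (repr (u n) : 'M[K]_2) i' j'.
  by rewrite (cvg_shiftS s); exact: uE.
pose X g := (g : 'M[K]_2) *m M *m adj22 g; pose w h := (h : 'M[K]_2) *m v.
have cX i j : X (repr (u n)) i j @[n --> \oo] --> X (repr P) i j.
  have cA k m : (repr (u n) : 'M[K]_2) i k * adj22 (repr (u n)) m j @[n --> \oo]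
      --> (repr P : 'M[K]_2) i k * adj22 (repr P) m j.
    have cN i' j' : (repr (u n) : 'M[K]_2) i k * - (repr (u n) : 'M[K]_2) i' j'
        @[n --> \oo] --> (repr P : 'M[K]_2) i k * - (repr P : 'M[K]_2) i' j'.
      rewrite mulrN; under eq_fun do rewrite mulrN.
      exact: cvgN.
    case: (ord2P m) => ->; case: (ord2P j) => ->; rewrite adj22E;
      under eq_fun do rewrite adj22E; by [exact: uE | exact: cN].
  have XE g : X g i j = M 0 0 * ((g : 'M[K]_2) i 0 * adj22 g 0 j)
      + M 1 0 * ((g : 'M[K]_2) i 1 * adj22 g 0 j)
      + M 0 1 * ((g : 'M[K]_2) i 0 * adj22 g 1 j)
      + M 1 1 * ((g : 'M[K]_2) i 1 * adj22 g 1 j).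
    by rewrite /X !mulmx22E; ring.
  rewrite XE; under eq_fun do rewrite XE.
  by apply: cvgD; [apply: cvgD; [apply: cvgD|]|]; apply: cvgMl_tmp; exact: cA.
have cw i j : w (repr (u n.+1)) i 0 * w (repr (u n.+1)) j 0 @[n --> \oo] -->
    w (repr P) i 0 * w (repr P) j 0.
  have wE h : w h i 0 * w h j 0 =
      v 0 0 * v 0 0 * ((h : 'M[K]_2) i 0 * (h : 'M[K]_2) j 0)
    + v 0 0 * v 1 0 * ((h : 'M[K]_2) i 0 * (h : 'M[K]_2) j 1)
    + v 0 0 * v 1 0 * ((h : 'M[K]_2) i 1 * (h : 'M[K]_2) j 0)
    + v 1 0 * v 1 0 * ((h : 'M[K]_2) i 1 * (h : 'M[K]_2) j 1).
    by rewrite /w !mulmx22E; ring.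
  rewrite wE; under eq_fun do rewrite wE.
  by apply: cvgD; [apply: cvgD; [apply: cvgD|]|]; apply: cvgMl_tmp; exact: u'E.
have qE (Y : 'M[K]_2) (z : 'cV[K]_2) : qform Y z = Y 1 0 * (z 0 0 * z 0 0)
    + Y 1 1 * (z 0 0 * z 1 0) - Y 0 0 * (z 1 0 * z 0 0) - Y 0 1 * (z 1 0 * z 1 0).
  by rewrite /qform /wedge !mulmx22E; ring.
have -> : qform M v = qform (X (repr P)) (w (repr P)).
  by rewrite -qform_conj mulVg val_oneg mul1mx.
under eq_fun do rewrite qform_conj -/(X _) -/(w _) qE.
by rewrite qE; apply: cvgB; [apply: cvgB; [apply: cvgD|]|]; apply: cvgM.
Qed.

(** If distinct [u n] converge, the quotients of consecutive terms tend to 1 without being 1.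
    Eventually they keep each of the finitely many [v l] in its open set, against the separation
    hypothesis. *)
Lemma separated_discrete (L : finType) (M : L -> 'M[K]_2) (v : L -> 'cV[K]_2)
    (H : set (PSL2 K)) :
  is_subgroup H -> (forall l, 0 < qform (M l) (v l)) ->
  (forall g, H (\pi_(PSL2 K) g) -> \pi_(PSL2 K) g <> 1%g ->
    exists l, ~~ (0 < qform (M l) ((g : 'M[K]_2) *m v l))) ->
  is_discrete H.
Proof.
move=> [H1 HM HV] vpos sep [u [inj_u Hu [P uP]]].
have /filter_forall : forall l, \forall n \near \oo,
    0 < qform (M l) (((repr (u n))^-1 * repr (u n.+1))%g *m v l).
  by move=> l; exact: (cvgr_gt _ (@cvg_qform_conj u P (M l) (v l) uP) _ (vpos l)).
move=> [N _ /(_ N (leqnn N)) posN].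
have piE : \pi_(PSL2 K) ((repr (u N))^-1 * repr (u N.+1))%g =
    ((u N)^-1 * u N.+1)%g by rewrite piM piV !reprK.
have [||l /negP[]] := sep ((repr (u N))^-1 * repr (u N.+1))%g; last exact: posN.
- by rewrite piE; apply: HM => //; apply: HV.
- rewrite piE => uE; have /inj_u/eqP : u N.+1 = u N.
    by rewrite -[LHS](mulVKg (u N)) uE mulg1.
  by rewrite gtn_eqF.
Qed.

End Topology.

(** * Ping-pong on the projective line *)

Section PingPong.
Variable K : realType.
Implicit Types (l : 'I_2 * bool) (v w : 'cV[K]_2).

(** Each letter maps the domains of all letters but its inverse into its own. Hence a reduced word
    carries a suitable base point into the domain of its first letter, which gives freeness and
    separation at once. *)
Lemma ping_pong (e : 'I_2 -> SL2 K) (M : 'I_2 * bool -> 'M[K]_2)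
    (v : 'I_2 * bool -> 'cV[K]_2) :
  (forall l, 0 < qform (M l) (v l)) ->
  (forall l l' w, 0 < qform (M l) w -> 0 < qform (M l') w -> l = l') ->
  (forall l l' w, ~~ cancelling l l' -> 0 < qform (M l') w ->
    0 < qform (M l) ((letter e l : 'M[K]_2) *m w)) ->
  is_discrete (generated (range (fun i => \pi_(PSL2 K) (e i))))
  /\ free_family (fun i => \pi_(PSL2 K) (e i)).
Proof.
move=> pos dis contr; pose f i := \pi_(PSL2 K) (e i).
have pi_eval s : \pi_(PSL2 K) (eval_word e s) = eval_word f s.
  elim: s => [|l s IHs]; first by rewrite !eval_nil.
  by rewrite !eval_cons piM IHs; case: l => i []; rewrite /letter /= ?piV.
have word_mem s : forall l l' w, reduced (rcons (l :: s) l') ->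
    0 < qform (M l') w -> 0 < qform (M l) ((eval_word e (l :: s) : 'M[K]_2) *m w).
  elim: s => [|a s IHs] l l' w; rewrite eval_cons val_mulg -mulmxA.
    rewrite [rcons _ _]/= reduced_cons2 => /andP[ll' _] Dw.
    by rewrite eval_nil val_oneg mul1mx; exact: contr Dw.
  rewrite [rcons _ _]/= reduced_cons2 => /andP[la rs] Dw.
  by apply: contr la _; apply: IHs Dw.
have moved s : reduced s -> s <> [::] ->
    exists l, ~~ (0 < qform (M l) ((eval_word e s : 'M[K]_2) *m v l)).
  case: s => // a s rs _; pose c := last a s.
  (* The letter [b] uses another generator than the first letter [a], so their domains are disjoint;
     it shares the exponent sign of the last letter [c], so the word stays reduced when [b] is
     appended. *)
  pose b : 'I_2 * bool := (if a.1 == 0 then 1 else 0, c.2).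
  have ba : b.1 <> a.1.
    by rewrite /b /=; case: eqP => [->|/eqP a1] // /esym/eqP; rewrite (negPf a1).
  have rb : reduced (rcons (a :: s) b).
    rewrite /reduced /= rcons_path; apply/andP; split; first exact: rs.
    by rewrite -/c /b /= eqxx andbF.
  have Da := word_mem s a b _ rb (pos b).
  exists b; apply/negP => Db; apply: ba.
  by rewrite (dis _ _ _ Da Db).
have sep s : reduced s -> s <> [::] -> forall g, \pi_(PSL2 K) g = eval_word f s ->
    exists l, ~~ (0 < qform (M l) ((g : 'M[K]_2) *m v l)).
  move=> rs s0 g; rewrite -pi_eval => /pi_eq gE.
  have [l Dl] := moved s rs s0; exists l.
  by case: gE => ->; rewrite // mulNmx qformN.
split; last first.
  move=> s rs s0 s1; have [//|l] := sep s rs s0 1%g.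
  by rewrite val_oneg mul1mx pos.
apply: (separated_discrete (generated_subgroup _) pos) => g /generated_eval[s0 gE].
have [s rs sE] := reduced_exists f s0; rewrite -gE -/f -sE => s1.
apply: (sep s rs) => [s0E|]; first by apply: s1; rewrite s0E eval_nil.
by rewrite -gE -/f -sE.
Qed.

Lemma wedge_adj (A : 'M[K]_2) v w : wedge (A *m v) w = wedge v (adj22 A *m w).
Proof. by rewrite /wedge !mx22E; ring. Qed.

Lemma qform_comp (A M : 'M[K]_2) v :
  qform (adj22 A *m M *m A) v = qform M (A *m v).
Proof. by rewrite /qform wedge_adj !mulmxA. Qed.

Definition on_letters (T : Type) (a a' b b' : T) l : T :=
  if l.1 == 0 then if l.2 then a' else a else if l.2 then b' else b.

Lemma lettersP l : [\/ l = (0, false), l = (0, true), l = (1, false) | l = (1, true)].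
Proof.
by case: l => i [] ; case: (ord2P i) => ->;
  [apply: Or42|apply: Or44|apply: Or41|apply: Or43].
Qed.

(* If q1, q2, q3 are positive on disjoint intervals of the projective line and
   r_i exchanges the interval of q_i with its complement, then r1, r2, r3 play
   ping-pong; the index-two subgroup generated by r1 r2 and r2 r3 plays it on
   the intervals of q1, q3 and their images under r2. *)
Lemma three_involutions (r1 r2 r3 M1 M3 : 'M[K]_2) (q2 : 'cV[K]_2 -> K)
    (s : bool) (g h : SL2 K) :
  r2 *m r2 = (-1) ^+ s *: 1%:M ->
  (g : 'M[K]_2) = r1 *m r2 -> (h : 'M[K]_2) = r2 *m r3 ->
  (forall v, qform M1 (r1 *m v) = - qform M1 v) ->
  (forall v, q2 (r2 *m v) = - q2 v) ->
  (forall v, qform M3 (r3 *m v) = - qform M3 v) ->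
  (forall v, 0 < qform M1 v -> q2 v < 0 /\ qform M3 v < 0) ->
  (forall v, 0 < q2 v -> qform M1 v < 0 /\ qform M3 v < 0) ->
  (forall v, 0 < qform M3 v -> qform M1 v < 0 /\ q2 v < 0) ->
  (exists v, 0 < qform M1 v) -> (exists v, 0 < qform M3 v) ->
  is_discrete (generated [set \pi_(PSL2 K) g; \pi_(PSL2 K) h])
  /\ free_of_rank 2 (generated [set \pi_(PSL2 K) g; \pi_(PSL2 K) h]).
Proof.
move=> r22 gE hE q1r q2r q3r d1 d2 d3 [v1 pos1] [v3 pos3].
pose e (i : 'I_2) := if i == 0 then g else h.
have -> : [set \pi_(PSL2 K) g; \pi_(PSL2 K) h] = range (fun i => \pi_(PSL2 K) (e i)).
  apply/seteqP; split=> [_ [->|->]|_ [i _ <-]]; first by exists 0.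
    by exists 1.
  by case: (ord2P i) => ->; [left|right].
(* For reflections ([s] false) as for half-turns ([s] true), the square of [r2] acts trivially on
   the projective line. *)
have s22 (M : 'M[K]_2) v : qform M (r2 *m (r2 *m v)) = qform M v.
  rewrite mulmxA r22 -scalemxAl mul1mx; case: s {r22}; rewrite ?expr0 ?scale1r //.
  by rewrite expr1 scaleN1r qformN.
pose M1' := adj22 r2 *m M1 *m r2; pose M3' := adj22 r2 *m M3 *m r2.
have M1'E v : qform M1' v = qform M1 (r2 *m v) by rewrite qform_comp.
have M3'E v : qform M3' v = qform M3 (r2 *m v) by rewrite qform_comp.
have gM v : qform M1 ((g : 'M[K]_2) *m v) = - qform M1' v.
  by rewrite gE -mulmxA q1r M1'E.
have hM v : qform M3' ((h : 'M[K]_2) *m v) = - qform M3 v.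
  by rewrite hE M3'E -mulmxA s22 q3r.
have gV v : qform M1' ((g^-1)%g *m v) = - qform M1 v.
  by apply: oppr_inj; rewrite -gM mulmxA -val_mulg mulgV val_oneg mul1mx opprK.
have hV v : qform M3 ((h^-1)%g *m v) = - qform M3' v.
  by apply: oppr_inj; rewrite -hM mulmxA -val_mulg mulgV val_oneg mul1mx opprK.
have d1' v : 0 < qform M1' v -> 0 < q2 v /\ qform M3' v < 0.
  by rewrite M1'E M3'E => /d1[]; rewrite q2r oppr_lt0.
have d3' v : 0 < qform M3' v -> 0 < q2 v /\ qform M1' v < 0.
  by rewrite M1'E M3'E => /d3[]; rewrite q2r oppr_lt0.
have d2' v : q2 v < 0 -> qform M1' v < 0 /\ qform M3' v < 0.
  by rewrite M1'E M3'E -oppr_gt0 -q2r => /d2.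
suff [dsc fr] : is_discrete (generated (range (fun i => \pi_(PSL2 K) (e i))))
    /\ free_family (fun i => \pi_(PSL2 K) (e i)).
  by split=> //; exists (fun i => \pi_(PSL2 K) (e i)).
(* The attracting domains of g, its inverse, h and its inverse are those of [M1], [M1'], [M3'] and
   [M3]; the primed ones lie where [q2] is positive. *)
apply: (@ping_pong e (on_letters M1 M1' M3' M3)
  (on_letters v1 (r2 *m v1) (r2 *m v3) v3)) => [l|l l' v|l l' v].
- by case: (lettersP l) => ->; rewrite /on_letters /= ?M1'E ?M3'E ?s22.
- have D1 := d1 v; have D2 := d2 v; have D3 := d3 v.
  have D1' := d1' v; have D2' := d2' v; have D3' := d3' v.
  by case: (lettersP l) => ->; case: (lettersP l') => ->;
    rewrite /on_letters //= => p q;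
    exfalso; clear - D1 D2 D3 D1' D2' D3' p q; intuition lra.
- have D1 := d1 v; have D2 := d2 v; have D3 := d3 v.
  have D1' := d1' v; have D2' := d2' v; have D3' := d3' v.
  by case: (lettersP l) => ->; case: (lettersP l') => ->;
    rewrite /on_letters /letter /cancelling //= /e ?gM ?hM ?gV ?hV ?oppr_gt0 => _ p;
    clear - D1 D2 D3 D1' D2' D3' p; intuition lra.
Qed.

End PingPong.

(** * Reflections in disjoint geodesics: the pair of pants *)

Section PantsAndTorus.
Variable K : realType.
Implicit Types (A B C : 'M[K]_2) (v w : 'cV[K]_2) (g h : SL2 K).

Lemma traceless_sqr A : \tr A = 0 -> A *m A = - \det A *: 1%:M.
Proof.
rewrite mxtrace22E => trA; have a11 : A 1 1 = - A 0 0 by lra.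
by apply: matrix22P; rewrite !(mx22E, mxE) a11 ?mulr1n ?mulr0n; ring.
Qed.

Lemma qform_mul_self A v : qform A (A *m v) = \det A * qform A v.
Proof. by rewrite /qform wedge_mul. Qed.

Lemma qformZ a A v : qform (a *: A) v = a * qform A v.
Proof. by rewrite /qform -scalemxAl wedgeZr. Qed.

Lemma qformD A B v : qform (A + B) v = qform A v + qform B v.
Proof. by rewrite /qform mulmxDl wedgeDr. Qed.

(** If every vector is an eigenvector, then [A] is scalar; three test vectors suffice. *)
Lemma qform_eq0 A : (forall v, qform A v = 0) -> \det A = (A 0 0) ^+ 2.
Proof.
move=> A0.
have := A0 (\col_i (i == 0)%:R); have := A0 (\col_i (i == 1)%:R).
have := A0 (\col_i 1).
rewrite /qform /wedge !(mx22E, mxE) /= => e11 e01 e10.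
have -> : A 1 1 = A 0 0 by lra.
have -> : A 0 1 = 0 by lra.
by ring.
Qed.

(** Applying [A] multiplies the form by its negative determinant, so a single nonzero value is
    enough. *)
Lemma qform_pos A : \det A < 0 -> exists v, 0 < qform A v.
Proof.
move=> dA; suff [v /eqP v0] : exists v, qform A v <> 0.
  have [v0'|v0'] := ltrP 0 (qform A v); first by exists v.
  exists (A *m v); rewrite qform_mul_self nmulr_rgt0 //.
  by rewrite lt_neqAle v0.
apply: contrapT => nex; suff: 0 <= \det A by rewrite leNgt dA.
rewrite qform_eq0 ?sqr_ge0 // => v; apply: contrapT => v0.
by apply: nex; exists v.
Qed.

(* Traceless matrices form a Minkowski space for -det; A 1 0 - A 0 1 is the
   time coordinate. *)
Definition timeC A := A 1 0 - A 0 1.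

(** The discriminant of the form is a negative multiple of [\det A]: a causal vector of the
    Minkowski space has a semidefinite form, with the sign of its time coordinate. *)
Lemma qform_semidef A v : \tr A = 0 -> 0 <= \det A -> timeC A <= 0 ->
  qform A v <= 0.
Proof.
rewrite /timeC /qform /wedge !mx22E => trA; have -> : A 1 1 = - A 0 0 by lra.
set a := A 0 0; set b := A 0 1; set c := A 1 0; set x := v 0 0; set y := v 1 0.
move=> dA tA; have bc : b * c <= 0 by nra.
have [c0 b0] : c <= 0 /\ 0 <= b.
  by split; rewrite leNgt; apply/negP => lt0; nra.
have [c00|c00] := eqVneq c 0.
  have a0 : a = 0 by nra.
  by nra.
have cneg : c < 0 by rewrite lt_neqAle c00.
have : 0 <= c * (x * (c * x + - a * y) - y * (a * x + b * y)).
  have -> : c * (x * (c * x + - a * y) - y * (a * x + b * y)) =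
    (c * x - a * y) ^+ 2 + (a * - a - b * c) * y ^+ 2 by ring.
  by rewrite addr_ge0 ?sqr_ge0 // mulr_ge0 ?sqr_ge0.
by rewrite nmulr_rge0.
Qed.

(** Causal vectors of opposite time orientation have nonnegative trace pairing, by the reversed
    Cauchy-Schwarz inequality. *)
Lemma timeC_sign A B : \tr A = 0 -> \tr B = 0 -> 0 <= \det A -> 0 <= \det B ->
  \tr (A *m B) < 0 -> timeC A <= 0 -> timeC B <= 0.
Proof.
rewrite /timeC !mx22E => trA trB.
have -> : A 1 1 = - A 0 0 by lra.
have -> : B 1 1 = - B 0 0 by lra.
set a := A 0 0; set b := A 0 1; set c := A 1 0.
set a' := B 0 0; set b' := B 0 1; set c' := B 1 0.
move=> dA dB trAB tA; rewrite leNgt; apply/negP => tB.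
have [c0 b0] : c <= 0 /\ 0 <= b.
  by split; rewrite leNgt; apply/negP => lt0; nra.
have [c'0 b'0] : 0 <= c' /\ b' <= 0.
  by split; rewrite leNgt; apply/negP => lt0; nra.
have : (a * a') ^+ 2 <= (b * c') * (c * b').
  have -> : (b * c') * (c * b') = (- (b * c)) * (- (b' * c')) by ring.
  by rewrite exprMn ler_pM ?sqr_ge0 //; nra.
have {}trAB : 2 * (a * a') + b * c' + c * b' < 0 by lra.
have p1 : 0 <= b * c' by rewrite mulr_ge0.
have p2 : 0 <= c * b' by rewrite mulr_le0.
move: trAB p1 p2; set p := b * c'; set q := c * b'; set r := a * a'.
clearbody p q r => trAB p1 p2 rpq.
have h1 : 0 < - (2 * r) - (p + q) by lra.
have h2 : 0 < - (2 * r) + (p + q) by lra.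
(* The product gives [4 r^2 > (p + q)^2 >= 4 p q], against [r^2 <= p q]. *)
by have := mulr_gt0 h1 h2; have := sqr_ge0 (p - q); lra.
Qed.

(** The commutator trace exceeds 2, so the normalized bracket [r2] has determinant -1 and is a
    reflection, as are [r1] and [r3]. The trace bounds make pairwise sums of the reflections causal
    with a common time orientation; the sums of forms are then semidefinite of one sign, which makes
    the intervals disjoint. *)
Lemma pants_discrete_free g h : 2 <= \tr g -> 2 <= \tr h -> \tr (g * h)%g <= -2 ->
  is_discrete (generated [set \pi_(PSL2 K) g; \pi_(PSL2 K) h])
  /\ free_of_rank 2 (generated [set \pi_(PSL2 K) g; \pi_(PSL2 K) h]).
Proof.
move=> trg trh trgh; pose C := (g : 'M[K]_2) *m h - (h : 'M[K]_2) *m g.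
pose d2 := \tr (commutator g h) - 2.
have detC : \det C = - d2 by rewrite det_bracket_SL2 /d2; ring.
have d2_gt0 : 0 < d2.
  rewrite /d2 trace_commutator /tau.
  move: trg trh trgh; set x := \tr g; set y := \tr h; set z := \tr _ => x2 y2 z2.
  have : 0 <= x * y * - z by rewrite !mulr_ge0 //; lra.
  have x4 : 4 <= x ^+ 2 by nra.
  have y4 : 4 <= y ^+ 2 by nra.
  have z4 : 4 <= z ^+ 2 by nra.
  by lra.
pose d := Num.sqrt d2; have dd : d * d = d2 by rewrite -expr2 sqr_sqrtr // ltW.
have d0 : d != 0 by rewrite gt_eqF // sqrtr_gt0.
pose r2 := d^-1 *: C; pose r1 := (g : 'M[K]_2) *m r2; pose r3 := r2 *m (h : 'M[K]_2).
have trC : \tr C = 0 by rewrite linearB /= mxtrace_mulC subrr.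
have tr2 : \tr r2 = 0 by rewrite linearZ /= trC mulr0.
have det2 : \det r2 = -1.
  by rewrite detZ detC exprVn expr2 dd mulrN mulVf // gt_eqF.
have r22 : r2 *m r2 = 1%:M by rewrite traceless_sqr // det2 opprK scale1r.
have det1 : \det r1 = -1 by rewrite det_mulmx det_SL2 det2 mul1r.
have det3 : \det r3 = -1 by rewrite det_mulmx det_SL2 det2 mulr1.
have tr1 : \tr r1 = 0.
  rewrite /r1 /r2 -scalemxAr linearZ /= (_ : \tr _ = 0) ?mulr0 //.
  by rewrite /C !(mx22E, mxE); ring.
have tr3 : \tr r3 = 0.
  rewrite /r3 /r2 -scalemxAl linearZ /= (_ : \tr _ = 0) ?mulr0 //.
  by rewrite /C !(mx22E, mxE); ring.
have gE : (g : 'M[K]_2) = r1 *m r2 by rewrite -mulmxA r22 mulmx1.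
have hE : (h : 'M[K]_2) = r2 *m r3 by rewrite mulmxA r22 mul1mx.
have ghE : ((g * h)%g : 'M[K]_2) = r1 *m r3.
  by rewrite val_mulg {1}gE {1}hE -mulmxA (mulmxA r2) r22 mul1mx.
(* With the sign of [r2] reversed, all three pairwise traces are at most -2. *)
pose s2 := - r2; have trs2 : \tr s2 = 0 by rewrite raddfN /= tr2 oppr0.
have dets2 : \det s2 = -1 by rewrite /s2 -[- r2]scaleN1r detZ sqrrN expr1n mul1r.
have trss A B : \tr A = 0 -> \tr B = 0 -> \det A = -1 -> \det B = -1 ->
    [/\ \tr (A + B) = 0, \det (A + B) = - 2 - \tr (A *m B)
      & forall C, \tr ((A + B) *m C) = \tr (A *m C) + \tr (B *m C)].
  move=> trA trB detA detB; split; first by rewrite linearD /= trA trB addr0.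
  - have -> : \det (A + B) = \det A + \det B + \tr A * \tr B - \tr (A *m B).
      by rewrite !(mx22E, mxE); ring.
    by rewrite detA detB trA; ring.
  - by move=> X; rewrite mulmxDl linearD.
have t12 : \tr (r1 *m s2) = - \tr g by rewrite mulmxN -gE raddfN.
have t23 : \tr (s2 *m r3) = - \tr h by rewrite mulNmx -hE raddfN.
have t13 : \tr (r1 *m r3) = \tr (g * h)%g by rewrite ghE.
have [tr12 det12 tr12X] := trss r1 s2 tr1 trs2 det1 dets2.
have [tr23 det23 tr23X] := trss s2 r3 trs2 tr3 dets2 det3.
have [tr13 det13 tr13X] := trss r1 r3 tr1 tr3 det1 det3.
have d12 : 0 <= \det (r1 + s2) by rewrite det12 t12; lra.
have d23 : 0 <= \det (s2 + r3) by rewrite det23 t23; lra.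
have d13 : 0 <= \det (r1 + r3) by rewrite det13 t13; lra.
have sqr_tr A : \tr A = 0 -> \det A = -1 -> \tr (A *m A) = 2.
  by move=> tA dA; rewrite traceless_sqr // dA opprK scale1r mxtrace1.
have x12_23 : \tr ((r1 + s2) *m (s2 + r3)) < 0.
  rewrite tr12X !mulmxDr !linearD /= t12 t23 t13 sqr_tr //; lra.
have x12_13 : \tr ((r1 + s2) *m (r1 + r3)) < 0.
  rewrite tr12X !mulmxDr !linearD /= (mxtrace_mulC s2 r1) t12 t23 t13 sqr_tr //; lra.
(* The sign [t], 1 or -1, turns the common time orientation into the nonpositive one. *)
have [t tt orient] : exists2 t : K, t * t = 1 & [/\ timeC (t *: (r1 + s2)) <= 0,
    timeC (t *: (s2 + r3)) <= 0 & timeC (t *: (r1 + r3)) <= 0].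
  have timeZ a A : timeC (a *: A) = a * timeC A by rewrite /timeC !mxE; ring.
  have oppP A B : \tr A = 0 -> \tr B = 0 -> 0 <= \det A -> 0 <= \det B ->
      \tr (A *m B) < 0 -> 0 < timeC A -> 0 <= timeC B.
    move=> trA trB dA dB trAB tA; have := @timeC_sign (-1 *: A) (-1 *: B).
    rewrite !timeZ -scalemxAl -scalemxAr !linearZ /= !detZ trA trB !mulr0.
    rewrite sqrrN expr1n !mul1r !mulN1r opprK !oppr_le0; apply => //; exact: ltW.
  have [t12_le|t12_gt] := lerP (timeC (r1 + s2)) 0.
  - exists 1; rewrite ?mulr1 // !scale1r.
    by split=> //; [apply: (timeC_sign tr12 tr23)|apply: (timeC_sign tr12 tr13)].
  - exists (-1); rewrite ?mulrNN ?mulr1 // !timeZ !mulN1r !oppr_le0.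
    by split; [exact: ltW|apply: (oppP _ _ tr12 tr23)|apply: (oppP _ _ tr12 tr13)].
have semi A v : \tr A = 0 -> 0 <= \det A -> timeC (t *: A) <= 0 ->
    t * qform A v <= 0.
  move=> trA dA tA; rewrite -qformZ; apply: qform_semidef => //.
    by rewrite linearZ /= trA mulr0.
  by rewrite detZ expr2 tt mul1r.
case: orient => o12 o23 o13.
have neg12 v : t * qform r1 v + t * qform s2 v <= 0.
  by rewrite -mulrDr -qformD semi.
have neg23 v : t * qform s2 v + t * qform r3 v <= 0.
  by rewrite -mulrDr -qformD semi.
have neg13 v : t * qform r1 v + t * qform r3 v <= 0.
  by rewrite -mulrDr -qformD semi.
have flip A v : \det A = -1 -> qform (t *: A) (A *m v) = - qform (t *: A) v.
  by move=> dA; rewrite !qformZ qform_mul_self dA mulN1r mulrN.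
have posf A : \det A = -1 -> exists v, 0 < qform (t *: A) v.
  by move=> dA; apply: qform_pos; rewrite detZ dA expr2 tt mul1r oppr_lt0.
apply: (@three_involutions _ r1 r2 r3 (t *: r1) (t *: r3) (fun v => t * qform s2 v)
  false) => //; rewrite ?expr0 ?scale1r //; try exact: posf;
  try by move=> v; exact: flip.
- move=> v; rewrite (_ : qform s2 (r2 *m v) = - qform s2 v) ?mulrN //.
  have -> : r2 *m v = s2 *m (- v) by rewrite mulmxN mulNmx opprK.
  by rewrite qform_mul_self dets2 qformN mulN1r.
- by move=> v; rewrite !qformZ; have := neg12 v; have := neg13 v; lra.
- by move=> v; rewrite !qformZ; have := neg12 v; have := neg23 v; lra.
- by move=> v; rewrite !qformZ; have := neg13 v; have := neg23 v; lra.
Qed.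

End PantsAndTorus.

(** * Half-turns about the sides of an ideal triangle: the one-holed torus *)

Section Torus.
Variable K : realType.
Implicit Types (A B C : 'M[K]_2) (v w p q : 'cV[K]_2) (g h : SL2 K).

(** The eigenvalues of a half-turn are [i] and [-i], so it fixes no point of the real projective
    line. *)
Lemma wedge_elliptic A v : \tr A = 0 -> \det A = 1 -> v != 0 ->
  wedge v (A *m v) != 0.
Proof.
rewrite /wedge !mx22E => trA; have -> : A 1 1 = - A 0 0 by lra.
set a := A 0 0; set b := A 0 1; set c := A 1 0 => dA.
apply: contra_neq; set x := v 0 0; set y := v 1 0 => q0.
have c0 : c != 0 by apply/eqP => c0; have := sqr_ge0 a; rewrite c0 in dA; lra.
have xy : (c * x - a * y) ^+ 2 + y ^+ 2 = 0.
  transitivity (c * (x * (c * x + - a * y) - y * (a * x + b * y))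
    + (1 - (a * - a - b * c)) * y ^+ 2); first by ring.
  by rewrite dA q0; ring.
have y0 : y = 0.
  by apply/eqP; rewrite -sqrf_eq0; apply/eqP; have := sqr_ge0 (c * x - a * y);
    have := sqr_ge0 y; lra.
have x0 : x = 0.
  move: xy; rewrite y0 mulr0 subr0 expr0n addr0 => /eqP.
  by rewrite sqrf_eq0 mulf_eq0 (negPf c0) => /eqP.
by apply/colP => i; rewrite mxE; case: (ord2P i) => ->.
Qed.

(** Encodes an interval with prescribed ends [p] and [q]; the sign of [a] selects one of the two
    complementary arcs. *)
Lemma qform_prod a p q : exists M : 'M[K]_2,
  forall v, qform M v = a * (wedge v p * wedge v q).
Proof.
exists (\matrix_(i, j) (a * q i 0 * (if j == 0 then p 1 0 else - p 0 0))) => v.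
by rewrite /qform /wedge !mx22E !mxE /=; ring.
Qed.

Lemma real_eigenvector A : 4 <= (\tr A) ^+ 2 -> \det A = 1 ->
  exists v (a : K), [/\ v != 0, a != 0 & A *m v = a *: v].
Proof.
(* The larger root of the characteristic polynomial; it is nonzero because the constant term is
   1. *)
move=> trA dA; pose a := (\tr A + Num.sqrt ((\tr A) ^+ 2 - 4)) / 2.
have a2 : a ^+ 2 - \tr A * a + 1 = 0.
  have := @sqr_sqrtr _ ((\tr A) ^+ 2 - 4); rewrite subr_ge0 => /(_ trA).
  rewrite /a; set s := Num.sqrt _; set t := \tr A => s2.
  have -> : ((t + s) / 2) ^+ 2 - t * ((t + s) / 2) + 1 = (s ^+ 2 - t ^+ 2 + 4) / 4.
    by field.
  by rewrite s2; field.
have dAa : \det (A - a%:M)^T = 0.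
  rewrite det_tr.
  have -> : \det (A - a%:M) = a ^+ 2 - \tr A * a + \det A.
    by rewrite !(mx22E, mxE) ?mulr1n ?mulr0n; ring.
  by rewrite dA.
have /det0P[v v0 vA] := introT eqP dAa.
exists v^T, a; split.
- by apply: contra_neq v0 => v0; rewrite -[v]trmxK v0 trmx0.
- by apply/eqP => a0; rewrite a0 in a2; lra.
- have := congr1 trmx vA; rewrite trmx_mul trmxK trmx0 mulmxBl mul_scalar_mx.
  by move=> /eqP; rewrite subr_eq0 => /eqP.
Qed.

(** The bound says exactly that the product of the three half-turns has squared trace at least 4,
    hence a real eigenvector [v0]. Then [e3], [e2], [e1] exchange the ends of the sides [v0 v1],
    [v1 v2], [v2 v0] of an ideal triangle, and so each exchanges the arc behind its side with the
    complement. *)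
Lemma torus_discrete_free g h : \tr (commutator g h) <= -2 ->
  is_discrete (generated [set \pi_(PSL2 K) g; \pi_(PSL2 K) h])
  /\ free_of_rank 2 (generated [set \pi_(PSL2 K) g; \pi_(PSL2 K) h]).
Proof.
move=> trgh; pose C := (g : 'M[K]_2) *m h - (h : 'M[K]_2) *m g.
pose d2 := 2 - \tr (commutator g h).
have detC : \det C = d2 by rewrite det_bracket_SL2.
have d2_ge4 : 4 <= d2 by rewrite /d2; lra.
have d2_gt0 : 0 < d2 by lra.
pose d := Num.sqrt d2; have dd : d * d = d2 by rewrite -expr2 sqr_sqrtr // ltW.
have d0 : d != 0 by rewrite gt_eqF // sqrtr_gt0.
pose e2 := d^-1 *: C; pose e1 := - ((g : 'M[K]_2) *m e2).
pose e3 := - (e2 *m (h : 'M[K]_2)).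
have trC : \tr C = 0 by rewrite linearB /= mxtrace_mulC subrr.
have tr2 : \tr e2 = 0 by rewrite linearZ /= trC mulr0.
have det2 : \det e2 = 1.
  by rewrite detZ detC exprVn expr2 dd mulVf // gt_eqF.
have detN A : \det (- A) = \det A.
  by rewrite -[- A]scaleN1r detZ sqrrN expr1n mul1r.
have det1 : \det e1 = 1 by rewrite detN det_mulmx det_SL2 det2 mul1r.
have det3 : \det e3 = 1 by rewrite detN det_mulmx det_SL2 det2 mul1r.
have tr1 : \tr e1 = 0.
  rewrite /e1 /e2 -scalemxAr -scalerN linearZ /= (_ : \tr _ = 0) ?mulr0 //.
  by rewrite /C !(mx22E, mxE); ring.
have tr3 : \tr e3 = 0.
  rewrite /e3 /e2 -scalemxAl -scalerN linearZ /= (_ : \tr _ = 0) ?mulr0 //.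
  by rewrite /C !(mx22E, mxE); ring.
have sqr_e A v : \tr A = 0 -> \det A = 1 -> A *m (A *m v) = - v.
  by move=> tA dA; rewrite mulmxA traceless_sqr // dA scaleN1r mulNmx mul1mx.
have e22 : e2 *m e2 = - 1%:M by rewrite traceless_sqr // det2 scaleN1r.
have gE : (g : 'M[K]_2) = e1 *m e2 by rewrite mulNmx -mulmxA e22 mulmxN mulmx1 opprK.
have hE : (h : 'M[K]_2) = e2 *m e3 by rewrite mulmxN mulmxA e22 mulNmx mul1mx opprK.
(* The trace of [g C h] equals [\det C], so the product of the half-turns has trace [-d]. *)
have trN : (\tr (e1 *m e2 *m e3)) ^+ 2 = d2.
  have -> : e1 *m e2 *m e3 = - d^-1 *: ((g : 'M[K]_2) *m C *m (h : 'M[K]_2)).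
    by rewrite -gE /e3 /e2 mulmxN -scalemxAl -scalemxAr mulmxA scaleNr.
  rewrite linearZ /= (_ : \tr _ = d2).
    by rewrite exprMn sqrrN exprVn {1}expr2 dd expr2 mulrA mulVf ?mul1r ?gt_eqF.
  have -> : \tr ((g : 'M[K]_2) *m C *m (h : 'M[K]_2)) = \det C.
    by rewrite /C !(mx22E, mxE); ring.
  exact: detC.
have [||v0 [a [v00 a0 eig]]] := @real_eigenvector (e1 *m e2 *m e3).
- by rewrite trN.
- by rewrite !det_mulmx det1 det2 det3 !mulr1.
pose v1 := e3 *m v0; pose v2 := e2 *m v1.
have e3v1 : e3 *m v1 = - v0 by rewrite sqr_e.
have e2v2 : e2 *m v2 = - v1 by rewrite sqr_e.
have e1v2 : e1 *m v2 = a *: v0 by rewrite -eig -!mulmxA.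
have e1v0 : e1 *m v0 = - a^-1 *: v2.
  apply: (scalerI a0); rewrite scalemxAr -e1v2 sqr_e // scalerA mulrN mulfV //.
  by rewrite scaleN1r.
have inv_ne0 A v : \det A = 1 -> v != 0 -> A *m v != 0.
  move=> dA; apply: contra_neq => Av0.
  have Au : A \in unitmx by rewrite unitmxE dA unitr1.
  by rewrite -[v](mulKmx Au) Av0 mulmx0.
have v10 : v1 != 0 by exact: inv_ne0.
have v20 : v2 != 0 by exact: inv_ne0.
pose D01 := wedge v0 v1; pose D12 := wedge v1 v2; pose D20 := wedge v2 v0.
have D01_0 : D01 != 0 by exact: wedge_elliptic.
have D12_0 : D12 != 0 by exact: wedge_elliptic.
have D20_0 : D20 != 0.
  have := wedge_elliptic tr1 det1 v20; rewrite e1v2 wedgeZr.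
  by rewrite mulf_eq0 negb_or => /andP[].
have wE A v w : \det A = 1 -> wedge (A *m v) (A *m w) = wedge v w.
  by move=> dA; rewrite wedge_mul dA mul1r.
have wNr v w : wedge v (- w) = - wedge v w by rewrite -scaleN1r wedgeZr mulN1r.
have w31 v : wedge (e3 *m v) v1 = wedge v v0 by rewrite wE.
have w30 v : wedge (e3 *m v) v0 = - wedge v v1.
  by rewrite -[v0]opprK -e3v1 wNr wE.
have w22 v : wedge (e2 *m v) v2 = wedge v v1 by rewrite wE.
have w21 v : wedge (e2 *m v) v1 = - wedge v v2.
  by rewrite -[v1]opprK -e2v2 wNr wE.
have w10 v : a * wedge (e1 *m v) v0 = wedge v v2.
  by rewrite -wedgeZr -e1v2 wE.
have w12 v : wedge (e1 *m v) v2 = - a * wedge v v0.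
  have -> : v2 = - a *: (e1 *m v0).
    by rewrite e1v0 scalerA mulrNN mulfV // scale1r.
  by rewrite wedgeZr wE.
have [M3 M3E] := qform_prod (D12 * D20) v0 v1.
have [M1 M1E] := qform_prod (D12 * D01) v0 v2.
(* The factors of [M1] and [M3] make the three forms pairwise products of [u0], [u1], [u2]. These
   sum to zero, so at most one of the products is positive: the arcs are disjoint. *)
pose u0 v := wedge v v0 * D12; pose u1 v := wedge v v1 * D20.
pose u2 v := wedge v v2 * D01; pose q2 v := u1 v * u2 v.
have q3E v : qform M3 v = u0 v * u1 v by rewrite M3E /u0 /u1; ring.
have q1E v : qform M1 v = u0 v * u2 v by rewrite M1E /u0 /u2; ring.
have u_sum v : u0 v + u1 v + u2 v = 0 by rewrite /u0 /u1 /u2 wedge_plucker.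
have sgn (x y z : K) : x + y + z = 0 -> 0 < x * y -> x * z < 0 /\ y * z < 0.
  move=> s xy; have -> : z = - (x + y) by lra.
  have := sqr_ge0 x; have := sqr_ge0 y.
  by split; lra.
apply: (@three_involutions _ e1 e2 e3 M1 M3 q2 true) => //.
- by rewrite expr1 scaleN1r.
- move=> v; rewrite !M1E; have <- : a^-1 * wedge v v2 = wedge (e1 *m v) v0.
    by rewrite -w10 mulKf.
  rewrite w12; transitivity (- (a^-1 * a) * (D12 * D01 * (wedge v v0 * wedge v v2))).
    by ring.
  by rewrite mulVf // mulN1r.
- by move=> v; rewrite /q2 /u1 /u2 w21 w22; ring.
- by move=> v; rewrite !M3E w30 w31; ring.
- move=> v; rewrite q1E q3E /q2 => pos.
  have [] := sgn (u0 v) (u2 v) (u1 v) _ pos; first by rewrite -(u_sum v); ring.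
  by rewrite (mulrC (u2 v)).
- move=> v; rewrite q1E q3E /q2 => pos.
  have [] := sgn (u1 v) (u2 v) (u0 v) _ pos; first by rewrite -(u_sum v); ring.
  by rewrite (mulrC (u2 v)) (mulrC (u1 v)).
- move=> v; rewrite q1E q3E /q2 => pos.
  by have [] := sgn (u0 v) (u1 v) (u2 v) _ pos.
(* The coefficient is chosen to make the value of the form a nonzero square; likewise for [M3]. *)
- exists (v0 + - (D12 * D01) *: v2); rewrite M1E.
  have -> : wedge (v0 + - (D12 * D01) *: v2) v0 = - (D12 * D01) * D20.
    by rewrite /D20 /wedge !mxE; ring.
  have -> : wedge (v0 + - (D12 * D01) *: v2) v2 = - D20.
    by rewrite /D20 /wedge !mxE; ring.
  have -> : D12 * D01 * (- (D12 * D01) * D20 * - D20) = (D12 * D01 * D20) ^+ 2.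
    by ring.
  by rewrite exprn_even_gt0 //= !mulf_neq0.
- exists (v0 + - (D12 * D20) *: v1); rewrite M3E.
  have -> : wedge (v0 + - (D12 * D20) *: v1) v0 = (D12 * D20) * D01.
    by rewrite /D01 /wedge !mxE; ring.
  have -> : wedge (v0 + - (D12 * D20) *: v1) v1 = D01.
    by rewrite /D01 /wedge !mxE; ring.
  have -> : D12 * D20 * (D12 * D20 * D01 * D01) = (D12 * D20 * D01) ^+ 2.
    by ring.
  by rewrite exprn_even_gt0 //= !mulf_neq0.
Qed.

End Torus.

(** * Chebyshev polynomials and elliptic elements *)

Section Elliptic.
Variable K : realType.
Implicit Types (g h : SL2 K) (t : K) (H : set (PSL2 K)).

Local Notation S t k := (chebyshevS K k).[t].

Lemma chebyshevS_rec t k : S t k.+2 = t * S t k.+1 - S t k.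
Proof. by rewrite [chebyshevS K k.+2]/= !hornerE. Qed.

Lemma chebyshevS0 t : S t 0 = 0. Proof. by rewrite horner0. Qed.

Lemma chebyshevS1 t : S t 1 = 1. Proof. by rewrite hornerE. Qed.

(** Cayley-Hamilton turns multiplication by [g] into the Chebyshev recursion on the coefficients. *)
Lemma expg_chebyshevS g k :
  (g ^+ k.+1)%g = S (\tr g) k.+1 *: (g : 'M[K]_2) - S (\tr g) k *: 1%:M :> 'M[K]_2.
Proof.
elim: k => [|k IHk].
  by rewrite expg1 chebyshevS1 chebyshevS0 scale1r scale0r subr0.
have gg : (g : 'M[K]_2) *m g = \tr g *: (g : 'M[K]_2) - 1%:M.
  have := mul_adj22 g; rewrite det_SL2 /adj22 mulmxBr mul_mx_scalar => <-.
  by rewrite opprB addrC subrK.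
rewrite expgS val_mulg IHk mulmxBr -!scalemxAr mulmx1 gg chebyshevS_rec.
rewrite scalerBr scalerA scalerBl (mulrC (\tr g)).
by rewrite -!addrA; congr (_ + _); rewrite addrC.
Qed.

(** The left side is the determinant of a power of a matrix of trace [t] and determinant 1. *)
Lemma chebyshevS_invariant t k :
  S t k ^+ 2 + S t k.+1 ^+ 2 - t * S t k * S t k.+1 = 1.
Proof.
elim: k => [|k <-]; last by rewrite chebyshevS_rec; ring.
by rewrite chebyshevS1 chebyshevS0; ring.
Qed.

Lemma chebyshevS_bounded t : t ^+ 2 < 4 -> exists B, forall k, `|S t k| <= B.
Proof.
move=> t4; have t4' : 0 < 4 - t ^+ 2 by lra.
(* Completing the square in the invariant, a definite form for [t ^+ 2 < 4], bounds the square of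
   each value by [B]; then [B + 1] bounds the value without a square root. *)
exists (4 / (4 - t ^+ 2) + 1) => k.
set B := 4 / (4 - t ^+ 2); have B0 : 0 <= B by rewrite divr_ge0 // ltW.
have : S t k ^+ 2 <= B.
  rewrite ler_pdivlMr //; have := chebyshevS_invariant t k.
  have := sqr_ge0 (2 * S t k.+1 - t * S t k).
  by set a := S t k; set b := S t k.+1 => *; lra.
move=> SB; rewrite ler_norml; set a := S t k in SB *; apply/andP; split.
- by rewrite leNgt; apply/negP => lt; nra.
- by rewrite leNgt; apply/negP => lt; nra.
Qed.

Lemma increasing_cvg (f : nat -> nat) : increasing_seq f -> f @ \oo --> \oo.
Proof.
move=> incf; apply/cvgnyPge => A; exists A => // n /= An.
apply: leq_trans An _; elim: n => // n IHn.
by apply: leq_ltn_trans IHn _; have /increasing_seqP/(_ n) := incf.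
Qed.

Lemma infinite_order_inj (G : groupType) (g : G) :
  infinite_order g -> injective (fun k : nat => g ^+ k)%g.
Proof.
move=> og a b; wlog ab : a b / (a <= b)%N.
  by move=> wl; case: (leqP a b) => [|/ltnW] ? *; [|apply/esym]; apply: wl.
rewrite -(subnK ab) expgnDr => /(canLR (mulgK _)); rewrite mulgV => /esym gab.
have [ba|/og//] := posnP (b - a)%N.
by rewrite ba.
Qed.

(* The powers of g are S_k(t) g - S_{k-1}(t) 1, with bounded coefficients when
   t^2 < 4. *)
Lemma discrete_trace H g : is_subgroup H -> is_discrete H ->
  H (\pi_(PSL2 K) g) -> infinite_order (\pi_(PSL2 K) g) -> 4 <= (\tr g) ^+ 2.
Proof.
move=> sH dH Hg og; rewrite leNgt; apply/negP => /chebyshevS_bounded[B SB].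
pose s k := S (\tr g) k; pose s' k := S (\tr g) k.+1.
have bnd (f : nat -> nat) : bounded_fun (fun k => s (f k)).
  by exists B; split; rewrite ?num_real // => x Bx k _; exact: le_trans (SB _) (ltW Bx).
(* Two successive extractions make both coefficients, at [k] and at [k.+1], converge along one
   subsequence. *)
have [f1 incf1 cvg1] := bolzano_weierstrass (bnd (fun k => k)).
have [f2 incf2 cvg2] := bolzano_weierstrass (bnd (fun k => (f1 k).+1)).
pose f k := f1 (f2 k); pose a := lim (s \o f1 @ \oo).
pose b := lim ((fun k => s (f1 k).+1) \o f2 @ \oo).
have cvga : s (f k) @[k --> \oo] --> a.
  by apply: (@cvg_comp _ _ _ f2 (s \o f1)) cvg1; exact: increasing_cvg.
have cvgb : s (f k).+1 @[k --> \oo] --> b by exact: cvg2.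
pose L := b *: (g : 'M[K]_2) - a *: 1%:M.
have detE x y : \det (y *: (g : 'M[K]_2) - x *: 1%:M) =
    x ^+ 2 + y ^+ 2 * \det g - \tr g * x * y.
  by rewrite !(mx22E, mxE) ?mulr1n ?mulr0n; ring.
have detL : \det L == 1.
  have cvgd : s (f k) ^+ 2 + s (f k).+1 ^+ 2 - \tr g * s (f k) * s (f k).+1
      @[k --> \oo] --> a ^+ 2 + b ^+ 2 - \tr g * a * b.
    apply: cvgB; first apply: cvgD.
    - exact: (cvgM cvga cvga).
    - exact: (cvgM cvgb cvgb).
    by apply: (cvgM _ cvgb); apply: cvgMl_tmp.
  rewrite detE det_SL2 mulr1; apply/eqP.
  rewrite -(cvg_lim (@norm_hausdorff _ _) cvgd).
  under eq_fun do rewrite chebyshevS_invariant.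
  exact: lim_cst.
apply: dH; exists (fun k => \pi_(PSL2 K) (g ^+ (f k).+1)%g); split.
- move=> i j; rewrite !piX => /(infinite_order_inj og)[].
  by move=> /(increasing_seq_injective incf1)/(increasing_seq_injective incf2).
- by move=> k; rewrite piX; exact: subgroup_expg.
exists (\pi_(PSL2 K) (MkSL2 detL)).
apply: (@cvg_comp _ _ _ (fun k => g ^+ (f k).+1)%g (fun h => \pi_(PSL2 K) h));
  last exact: pi_continuous.
apply: cvg_SL2 => i j; rewrite [X in _ --> X]mxE.
under eq_fun do rewrite expg_chebyshevS mxE.
apply: cvgD.
  by rewrite mxE; under eq_fun do rewrite mxE; apply: cvgMr_tmp.
rewrite !mxE; under eq_fun do rewrite !mxE.
by apply: cvgN; apply: cvgMr_tmp.
Qed.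

End Elliptic.

(** * The trace minimization algorithm *)

Section Traces.
Variable K : realType.
Implicit Types (g h : SL2 K) (x y z T d : K) (t u w : triple K).

Lemma perm_eq2 (a b x y : K) : perm_eq [:: a; b] [:: x; y] ->
  (x = a /\ y = b) \/ (x = b /\ y = a).
Proof.
move=> ab; have : x \in [:: a; b] by rewrite (perm_mem ab) mem_head.
rewrite !inE => /orP[]/eqP xE; rewrite {}xE in ab *; [left|right]; split=> //.
- by move: ab; rewrite perm_cons => /perm_mem/(_ b); rewrite !inE eqxx => /esym/eqP.
- move: ab; rewrite (perm_catC [:: a] [:: b]) perm_cons => /perm_mem/(_ a).
  by rewrite !inE eqxx => /esym/eqP.
Qed.

Lemma permuted_cases (a b c x y z : K) : permuted (a, b, c) (x, y, z) ->
  [\/ (x, y, z) = (a, b, c), (x, y, z) = (a, c, b) | (x, y, z) = (b, a, c)]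
  \/ [\/ (x, y, z) = (b, c, a), (x, y, z) = (c, a, b) | (x, y, z) = (c, b, a)].
Proof.
rewrite /permuted /= => p.
have : x \in [:: a; b; c] by rewrite (perm_mem p) mem_head.
rewrite !inE => /or3P[]/eqP xE; rewrite {}xE in p *.
- move: p; rewrite perm_cons => /perm_eq2[[-> ->]|[-> ->]].
    by left; apply: Or31.
  by left; apply: Or32.
- move: p; rewrite (perm_catCA [:: a] [:: b] [:: c]) perm_cons.
  move=> /perm_eq2[[-> ->]|[-> ->]]; first by left; apply: Or33.
  by right; apply: Or31.
- move: p; rewrite (perm_catC [:: a; b] [:: c]) perm_cons.
  move=> /perm_eq2[[-> ->]|[-> ->]]; first by right; apply: Or32.
  by right; apply: Or33.
Qed.

Lemma tau_permuted t u : permuted t u -> tau u = tau t.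
Proof.
case: t u => [[a b] c] [[x y] z] /permuted_cases.
by case=> [][] [-> -> ->]; rewrite /tau; ring.
Qed.

Lemma tau_switched t u : sign_switched t u -> tau u = tau t.
Proof.
case: t => [[a b] c]; rewrite /sign_switched !inE.
by case/or4P => /eqP->; rewrite /tau; ring.
Qed.

(** Closure under the three operations of the algorithm. It is used with [Q] saying that the triple
    comes from a generating pair of a fixed group. *)
Definition move_closed (Q : triple K -> Prop) : Prop :=
  [/\ forall t u, permuted t u -> Q t -> Q u,
      forall t u, sign_switched t u -> Q t -> Q u
    & forall x y z, Q (x, y, z) -> Q (x, y, x * y - z)].

Lemma tma_move_closed (Q : triple K -> Prop) t u :
  move_closed Q -> tma t u -> Q t -> Q u.
Proof.
move=> [Qp Qs Qm] [_ [a [b [[[s ts sa] _] ab /andP[bu _]]]]] Qt.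
apply: (Qp _ _ bu); have {}Qt := Qs _ _ sa (Qp _ _ ts Qt); clear -Qt Qp Qm ab.
elim: ab Qt => // [[[x y] z]] v w _ /andP[xv _] _ IH Qu.
by apply/IH/(Qp _ _ xv)/Qm.
Qed.

Lemma permuted_rot x y z : permuted (x, y, z) (z, x, y).
Proof. by apply/permP => p /=; ring. Qed.

Lemma permuted_rotr x y z : permuted (x, y, z) (y, z, x).
Proof. by apply/permP => p /=; ring. Qed.

Lemma permuted_swap x y z : permuted (x, y, z) (x, z, y).
Proof. by apply/permP => p /=; ring. Qed.

(* The discriminant identity (2z - xy)^2 = (x^2 - 4)(y^2 - 4) + 4 (tau - 2)
   bounds from below the amount by which a step lowers the sum. *)
Lemma step_descent T d x y z : 2 < T -> 0 < d -> d ^+ 2 <= T - 2 ->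
  tau (x, y, z) = T -> 2 <= x -> x <= y -> y <= z -> d <= 2 * z - x * y.
Proof.
move=> T2 d0 dT tauT x2 xy yz.
have disc : (2 * z - x * y) ^+ 2 = (x ^+ 2 - 4) * (y ^+ 2 - 4) + 4 * (T - 2).
  by rewrite -tauT /tau; ring.
have x4 : 0 <= x ^+ 2 - 4 by nra.
have y4 : 0 <= y ^+ 2 - 4 by nra.
have xy4 := mulr_ge0 x4 y4.
have pos : 0 < 2 * z - x * y.
  (* If [2 z <= x y], then [y <= z] bounds the square of the difference by [(x - 2)^2 y^2], which is
     at most [(x^2 - 4) (y^2 - 4)]; the discriminant identity then contradicts [T > 2]. *)
  rewrite ltNge; apply/negP => neg.
  have h1 : x * y - 2 * z <= (x - 2) * y by lra.
  have h2 : (x * y - 2 * z) ^+ 2 <= ((x - 2) * y) ^+ 2.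
    by rewrite ler_sqr ?nnegrE //; lra.
  have h3 : 0 <= (x - 2) * (4 * y ^+ 2 - 4 * x - 8) by rewrite mulr_ge0 //; nra.
  by nra.
rewrite -ler_sqr ?nnegrE; [lra| |]; lra.
Qed.

(** * Termination of the algorithm when the commutator trace exceeds 2 *)

Section Termination.
Variables (Q : triple K -> Prop) (T d : K).
Hypotheses (Qc : move_closed Q) (T2 : 2 < T) (d0 : 0 < d) (dT : d ^+ 2 <= T - 2).
Hypothesis (Q2 : forall x y z, Q (x, y, z) -> 2 <= `|z|).

(** Induction on a bound for the sum in units of [d], since each step lowers the sum by at least
    [d]. As [Q] excludes entries strictly between -2 and 2, the first negative entry is at most
    -2. *)
Lemma tma_loop_terminates n x y z : Q (x, y, z) -> tau (x, y, z) = T ->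
  2 <= x -> x <= y -> y <= `|z| -> x + y + z <= n%:R * d ->
  exists w x' y' z', [/\ tma_loop T (x, y, z) w, tma_return T w (x', y', z'),
    2 <= x', 2 <= y' & z' <= -2].
Proof.
have [Qp _ Qm] := Qc.
have TF : (T < 2) = false by rewrite ltNge (ltW T2).
elim: n x y z => [|n IHn] x y z Qt tauT x2 xy yz sum.
all: have [z0|z0] := ltrP z 0.
1,3: exists (x, y, z), x, y, z; have := Q2 Qt; rewrite ltr0_norm // => z2.
1,2: split; [by apply: TmaStop; rewrite /tma_stop TF z0 !orbT| |lra..].
1,2: by rewrite /tma_return TF /permuted perm_refl xy z0 !andbT; lra.
all: rewrite ger0_norm // in yz.
  by rewrite mul0r in sum; lra.
have desc := step_descent T2 d0 dT tauT x2 xy yz.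
pose z' := x * y - z; have Qt' : Q (x, y, z') by exact: Qm.
have tauT' : tau (x, y, z') = T by rewrite -tauT /tau /z'; ring.
have nstop : ~~ tma_stop T (x, y, z) by rewrite /tma_stop TF !negb_or -!leNgt; lra.
have sum' : x + y + z' <= n%:R * d.
  by move: sum; rewrite -natr1 mulrDl mul1r /z'; lra.
have z'2 := Q2 Qt'.
have [z'0|z'0] := ltrP z' 0.
  (* A negative new entry comes first in increasing order and stops the loop; the return step moves
     it to the end. *)
  exists (z', x, y), x, y, z'; rewrite ltr0_norm // in z'2; split=> //; try lra.
  - apply: (@TmaStep _ _ _ (z', x, y)) => //; last first.
      by apply: TmaStop; rewrite /tma_stop TF z'0.
    by rewrite /tma_step permuted_rot /increasing /= xy andbT; lra.
  - by rewrite /tma_return permuted_rotr TF xy z'0 !andbT; lra.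
rewrite ger0_norm // in z'2.
have step (v : triple K) : let: (a, b, c) := v in
    permuted (x, y, z') v -> 2 <= a -> a <= b -> b <= c ->
  exists w x' y' z', [/\ tma_loop T (x, y, z) w, tma_return T w (x', y', z'),
    2 <= x', 2 <= y' & z' <= -2].
  case: v => [[a b] c] pv a2 ab bc.
  have [|||w [x' [y' [c' [loop ret x'2 y'2 c'2]]]]] :=
      IHn a b c (Qp _ _ pv Qt') _ a2 ab.
  - by rewrite (tau_permuted pv).
  - by rewrite ger0_norm //; lra.
  - suff -> : a + b + c = x + y + z' by [].
    by case: (permuted_cases pv) => [][] [-> -> ->]; ring.
  exists w, x', y', c'; split=> //; apply: TmaStep loop => //.
  by rewrite /tma_step -/z' pv /increasing /= ab bc.
have [z'x|/ltW xz'] := lerP z' x.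
  by apply: (step (z', x, y)); rewrite ?permuted_rot.
have [z'y|/ltW yz'] := lerP z' y.
  by apply: (step (x, z', y)); rewrite ?permuted_swap.
by apply: (step (x, y, z')); rewrite // /permuted perm_refl.
Qed.

Lemma tma_terminates t : Q t -> tau t = T ->
  exists x' y' z', [/\ tma t (x', y', z'), 2 <= x', 2 <= y' & z' <= -2].
Proof.
case: t => [[a b] c] Qt tauT; have [Qp Qs _] := Qc.
have TF : (T < 2) = false by rewrite ltNge (ltW T2).
(* Sorting by absolute value survives sign switches, so the first two entries can be made
   nonnegative afterwards. *)
pose le_abs (x y : K) := `|x| <= `|y|.
have le_abs_total : total le_abs by move=> x y; exact: le_total.
have sorted_abs := sort_sorted le_abs_total [:: a; b; c].
have := perm_sort le_abs [:: a; b; c]; have := size_sort le_abs [:: a; b; c].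
case: (sort _ _) sorted_abs => [|x [|y [|z [|? ?]]]] //= /and3P[xy yz _] _ ps.
have {}ps : permuted (a, b, c) (x, y, z) by rewrite /permuted /= perm_sym ps.
have Qxyz := Qp _ _ ps Qt.
have [u [su u1 u2 u3]] : exists u : triple K, [/\ sign_switched (x, y, z) u,
    0 <= u.1.1, u.1.1 <= u.1.2 & u.1.2 <= `|u.2|].
  rewrite /le_abs in xy yz.
  have [x0|x0] := lerP 0 x; have [y0|y0] := lerP 0 y.
  - rewrite (ger0_norm y0) in xy yz; rewrite (ger0_norm x0) in xy.
    by exists (x, y, z); rewrite /sign_switched !inE eqxx.
  - rewrite (ltr0_norm y0) in xy yz; rewrite (ger0_norm x0) in xy.
    by exists (x, - y, - z); rewrite /sign_switched !inE eqxx ?orbT normrN.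
  - rewrite (ger0_norm y0) in xy yz; rewrite (ltr0_norm x0) in xy.
    exists (- x, y, - z); rewrite /sign_switched !inE eqxx ?orbT normrN.
    by rewrite oppr_ge0 (ltW x0).
  - rewrite (ltr0_norm y0) in xy yz; rewrite (ltr0_norm x0) in xy.
    exists (- x, - y, z); rewrite /sign_switched !inE eqxx ?orbT.
    by rewrite oppr_ge0 (ltW x0).
case: u su u1 u2 u3 => [[x1 y1] z1] /= su u1 u2 u3.
have {}su : sign_switched (x, y, z) (x1, y1, z1) by [].
have Qu := Qs _ _ su Qxyz.
have x12 : 2 <= x1.
  (* [Q2] bounds the third entry only, so a rotation brings [x1] there. *)
  by have := Q2 (Qp _ _ (permuted_rotr x1 y1 z1) Qu); rewrite ger0_norm.
have tau1 : tau (x1, y1, z1) = T by rewrite (tau_switched su) (tau_permuted ps).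
have sum : x1 + y1 + z1 <= (Num.bound ((x1 + y1 + `|z1|) / d))%:R * d.
  (* The absolute value of [z1] keeps the argument of [Num.bound] nonnegative, as the Archimedean
     bound requires. *)
  rewrite -ler_pdivrMr //; apply: le_trans (ltW (archi_boundP _)).
    by rewrite ler_pM2r ?invr_gt0 // lerD2l ler_norm.
  by rewrite divr_ge0 ?(ltW d0) //; lra.
have [w [x' [y' [z' [loop ret ? ? ?]]]]] := tma_loop_terminates Qu tau1 x12 u2 u3 sum.
exists x', y', z'; split=> //; rewrite /tma tauT.
split; first by apply/eqP; rewrite gt_eqF.
exists (x1, y1, z1), w; split=> //; split; first by exists (x, y, z).
by rewrite tauT TF u1 u2.
Qed.

End Termination.

End Traces.

(** * Generating pairs *)

Section Generators.
Variable K : realType.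
Implicit Types (g h k : SL2 K) (H : set (PSL2 K)) (P Q : PSL2 K) (t : triple K).

(** Arbitrary lifts are allowed, not only those of nonnegative trace, so that switching two signs is
    a change of lifts. *)
Definition realizes H t : Prop := exists g h,
  H = generated [set \pi_(PSL2 K) g; \pi_(PSL2 K) h] /\
  t = (\tr g, \tr h, \tr (g * h)%g).

Lemma trace_invg g : \tr (g^-1)%g = \tr g.
Proof. by rewrite val_invg !mx22E addrC. Qed.

(** The moves are Nielsen moves: exchanging [g] and [h], passing to the inverse of [g] and [g h],
    and inverting [h]. The first two yield all permutations, the last the step of the algorithm. *)
Lemma realizes_move_closed H : move_closed (realizes H).
Proof.
have swap x y z : realizes H (x, y, z) -> realizes H (y, x, z).
  move=> [g [h [-> [-> -> ->]]]]; exists h, g; split; first by rewrite setUC.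
  by rewrite !val_mulg mxtrace_mulC.
have rot x y z : realizes H (x, y, z) -> realizes H (x, z, y).
  move=> [g [h [-> [-> -> ->]]]]; exists (g^-1)%g, (g * h)%g; split; last first.
    by rewrite trace_invg mulKg.
  set X := [set _; _]; set Y := [set _; _].
  have [_ XM XV] := generated_subgroup X; have [_ YM YV] := generated_subgroup Y.
  have Xg : generated X (\pi_(PSL2 K) g) by exact: generated_mem1.
  have Xh : generated X (\pi_(PSL2 K) h) by exact: generated_mem2.
  have Yg : generated Y (\pi_(PSL2 K) g).
    by rewrite -[g]invgK piV; apply: YV; exact: generated_mem1.
  have Yh : generated Y (\pi_(PSL2 K) h).
    have Ygh : generated Y (\pi_(PSL2 K) (g * h)%g) by exact: generated_mem2.
    by rewrite -[h](mulKg g) piM piV; apply: YM Ygh; exact: YV.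
  by apply: generated2_eq Yg Yh; [rewrite piV; exact: XV|rewrite piM; exact: XM].
split=> [[[a b] c] [[x y] z]|[[a b] c] u|x y z].
- move=> /permuted_cases abc Habc.
  by case: abc => [][] ->; auto.
- rewrite /sign_switched !inE => sw [g [h [-> [aE bE cE]]]].
  have mulN (X Y : 'M[K]_2) : - X *m - Y = X *m Y by rewrite mulNmx mulmxN opprK.
  case/or4P: sw => /eqP ->.
  + by exists g, h; rewrite aE bE cE.
  + exists (SL2_opp g), (SL2_opp h); rewrite !PSL2_piN; split=> //.
    by rewrite aE bE cE val_mulg /= mulN !raddfN.
  + exists (SL2_opp g), h; rewrite !PSL2_piN; split=> //.
    by rewrite aE bE cE val_mulg /= mulNmx !raddfN.
  + exists g, (SL2_opp h); rewrite !PSL2_piN; split=> //.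
    by rewrite aE bE cE val_mulg /= mulmxN !raddfN.
- move=> [g [h [-> [-> -> ->]]]]; exists g, (h^-1)%g; split; last first.
    rewrite trace_invg val_mulg val_invg trace_adj22; congr (_, _, _ - _).
  apply: generated2_eq; rewrite ?piV.
  + exact: generated_mem1.
  + have [_ _ V] := generated_subgroup [set \pi_(PSL2 K) g; \pi_(PSL2 K) h].
    by apply: V; exact: generated_mem2.
  + exact: generated_mem1.
  + have [_ _ V] := generated_subgroup [set \pi_(PSL2 K) g; ((\pi_(PSL2 K) h)^-1)%g].
    by have := V _ (@generated_mem2 _ _ _); rewrite invgK.
Qed.

Lemma discrete_free_trace H g : is_subgroup H -> is_discrete H ->
  free_of_rank 2 H -> H (\pi_(PSL2 K) g) -> 2 <= `|\tr g|.
Proof.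
move=> sH dH [e [He fe]] Hg.
have [g1|g1] := pselect (\pi_(PSL2 K) g = 1%g).
  have /pi_eq : \pi_(PSL2 K) g = \pi_(PSL2 K) 1%g by rewrite g1.
  by case=> ->; rewrite ?raddfN ?val_oneg /= mxtrace1 ?normrN ger0_norm.
have og : infinite_order (\pi_(PSL2 K) g).
  by apply: (free_torsion_free fe _ g1); rewrite -He.
have := discrete_trace sH dH Hg og.
by rewrite -(real_normK (num_real (\tr g))); have := normr_ge0 (\tr g); nra.
Qed.

Lemma lift_subgroup (F : 'M[K]_2 -> Prop) : F 1%:M ->
  (forall g h, F g -> F h -> F (g *m h)) -> (forall g, F g -> F (g^-1)%g) ->
  is_subgroup [set P | exists2 g, P = \pi_(PSL2 K) g & F g].
Proof.
move=> F1 FM FV; split; first by exists 1%g.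
- move=> _ _ [g -> Fg] [h -> Fh]; exists (g * h)%g; first by rewrite piM.
  exact: FM.
- by move=> _ [g -> Fg]; exists (g^-1)%g; [rewrite piV|exact: FV].
Qed.

(** [F] need not be invariant under negation, so it is propagated to some lift of each element
    only. *)
Lemma generated_lift g h (F : 'M[K]_2 -> Prop) : F 1%:M ->
  (forall g h, F g -> F h -> F (g *m h)) -> (forall g, F g -> F (g^-1)%g) ->
  F g -> F h -> forall P, generated [set \pi_(PSL2 K) g; \pi_(PSL2 K) h] P ->
  exists2 k, P = \pi_(PSL2 K) k & F k.
Proof.
move=> F1 FM FV Fg Fh; apply: (generated_sub (lift_subgroup F1 FM FV)) => P.
by case=> ->; [exists g|exists h].
Qed.

Lemma generated_centralizer g h (X : 'M[K]_2) :
  (g : 'M[K]_2) *m X = X *m g -> (h : 'M[K]_2) *m X = X *m h ->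
  forall P, generated [set \pi_(PSL2 K) g; \pi_(PSL2 K) h] P ->
  exists2 k, P = \pi_(PSL2 K) k & (k : 'M[K]_2) *m X = X *m k.
Proof.
move=> gX hX; apply: (@generated_lift g h (fun Y => Y *m X = X *m Y)) => //.
- by rewrite mul1mx mulmx1.
- by move=> a b aX bX; rewrite -mulmxA bX !mulmxA aX.
move=> a aX; have aa : (a^-1)%g *m (a : 'M[K]_2) = 1%:M by rewrite -val_mulg mulVg.
have aa' : (a : 'M[K]_2) *m (a^-1)%g = 1%:M by rewrite -val_mulg mulgV.
rewrite -[LHS]mulmx1 -aa' mulmxA -[_ *m X *m a]mulmxA -aX.
by rewrite !mulmxA aa mul1mx.
Qed.

Lemma row_kernel_line (C : 'M[K]_2) (v w : 'rV[K]_2) :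
  C != 0 -> v != 0 -> v *m C = 0 -> w *m C = 0 -> exists a, w = a *: v.
Proof.
move=> C0 v0 /rowP vC /rowP wC.
have vCj j : v 0 0 * C 0 j + v 0 1 * C 1 j = 0 by rewrite -mulmx22E vC mxE.
have wCj j : w 0 0 * C 0 j + w 0 1 * C 1 j = 0 by rewrite -mulmx22E wC mxE.
(* If [v] and [w] were independent, [C] would vanish. *)
have vw : v 0 0 * w 0 1 - v 0 1 * w 0 0 = 0.
  apply: contraNeq C0 => vw; apply/eqP/matrixP => i j; rewrite mxE.
  have C1 : (v 0 0 * w 0 1 - v 0 1 * w 0 0) * C 1 j = 0.
    transitivity (v 0 0 * (w 0 0 * C 0 j + w 0 1 * C 1 j)
      - w 0 0 * (v 0 0 * C 0 j + v 0 1 * C 1 j)); first by ring.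
    by rewrite vCj wCj; ring.
  have C2 : (v 0 0 * w 0 1 - v 0 1 * w 0 0) * C 0 j = 0.
    transitivity (w 0 1 * (v 0 0 * C 0 j + v 0 1 * C 1 j)
      - v 0 1 * (w 0 0 * C 0 j + w 0 1 * C 1 j)); first by ring.
    by rewrite vCj wCj; ring.
  by apply: (mulfI vw); rewrite mulr0; case: (ord2P i) => ->.
have [v00|v00] := eqVneq (v 0 0) 0; last first.
  exists (w 0 0 / v 0 0); apply/rowP => i; rewrite mxE; case: (ord2P i) => ->.
    by rewrite divfK.
  by apply: (mulfI v00); rewrite mulrA mulrCA mulfV // mulr1; lra.
have v01 : v 0 1 != 0.
  by apply: contra_neq v0 => v01; apply/rowP => i; rewrite mxE; case: (ord2P i) => ->.
exists (w 0 1 / v 0 1); apply/rowP => i; rewrite mxE; case: (ord2P i) => ->.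
  by apply: (mulfI v01); rewrite v00 mulr0; rewrite v00 in vw; lra.
by rewrite divfK.
Qed.

Lemma generated_eigenvector g h (v : 'rV[K]_2) : v != 0 ->
  (exists a, v *m g = a *: v) -> (exists a, v *m h = a *: v) ->
  forall P, generated [set \pi_(PSL2 K) g; \pi_(PSL2 K) h] P ->
  exists2 k, P = \pi_(PSL2 K) k & exists a, v *m k = a *: v.
Proof.
move=> v0; apply: (@generated_lift _ _ (fun X => exists a, v *m X = a *: v)).
- by exists 1; rewrite mulmx1 scale1r.
- by move=> a b [x ax] [y bY]; exists (x * y); rewrite mulmxA ax -scalemxAl bY scalerA.
- move=> a [x ax]; exists x^-1.
  have vE : v = x *: (v *m (a^-1)%g).
    by rewrite scalemxAl -ax -mulmxA -val_mulg mulgV mulmx1.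
  have x0 : x != 0 by apply: contra_neq v0 => x0; rewrite vE x0 scale0r.
  by rewrite {2}vE scalerA mulVf // scale1r.
Qed.

(** The bracket [C] is singular. If it is zero, [g] and [h] commute and so do lifts of all elements;
    otherwise its left kernel is a common eigenline. In both cases brackets of lifts are singular
    throughout the group. *)
Lemma trace2_elementary g h : \tr (commutator g h) = 2 ->
  elementary (generated [set \pi_(PSL2 K) g; \pi_(PSL2 K) h]).
Proof.
move=> gh2 P Q HP HQ _ _; pose C := (g : 'M[K]_2) *m h - (h : 'M[K]_2) *m g.
have detC : \det C = 0 by rewrite det_bracket_SL2 gh2 subrr.
suff [k [k' [-> -> det0]]] : exists k k', [/\ P = \pi_(PSL2 K) k,
    Q = \pi_(PSL2 K) k' & \det ((k : 'M[K]_2) *m k' - (k' : 'M[K]_2) *m k) = 0].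
  rewrite (trace_commutator_lift erefl erefl); move: det0.
  by rewrite det_bracket_SL2 => /eqP; rewrite subr_eq0 => /eqP.
have [C0|C0] := eqVneq C 0.
  have /eqP := C0; rewrite subr_eq0 => /eqP ghC.
  have [k PE kg] := @generated_centralizer g h g erefl (esym ghC) P HP.
  have [k1 PE1 kh] := @generated_centralizer g h h ghC erefl P HP.
  have {k1 PE1}kh : (k : 'M[K]_2) *m h = (h : 'M[K]_2) *m k.
    (* The two lifts of [P] agree up to sign, which does not affect commutation with [h]. *)
    have /pi_eq[->//|->] : \pi_(PSL2 K) k = \pi_(PSL2 K) k1 by rewrite -PE.
    by rewrite mulNmx mulmxN kh.
  have [k' QE kk'] := @generated_centralizer g h k (esym kg) (esym kh) Q HQ.
  by exists k, k'; split=> //; rewrite kk' subrr det0.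
have /det0P[v v0 vC] := introT eqP detC.
(* These relations make the left kernel of [C] invariant under [g] and [h]. *)
have gC : (g : 'M[K]_2) *m C = C *m adj22 g.
  by apply: matrix22P; rewrite /C !(mx22E, mxE); ring.
have hC : (h : 'M[K]_2) *m C = C *m adj22 h.
  by apply: matrix22P; rewrite /C !(mx22E, mxE); ring.
have vg : exists a, v *m g = a *: v.
  by apply: (row_kernel_line C0 v0 vC); rewrite -mulmxA gC mulmxA vC mul0mx.
have vh : exists a, v *m h = a *: v.
  by apply: (row_kernel_line C0 v0 vC); rewrite -mulmxA hC mulmxA vC mul0mx.
have [k PE [a ka]] := generated_eigenvector v0 vg vh HP.
have [k' QE [b kb]] := generated_eigenvector v0 vg vh HQ.
exists k, k'; split=> //; apply/eqP/det0P; exists v => //.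
rewrite mulmxBr !mulmxA ka kb -!scalemxAl ka kb !scalerA mulrC; exact: subrr.
Qed.

(** Powers are Chebyshev multiples of [g] and [h] up to scalar matrices, which drop out of the
    bracket; the identity follows on taking determinants. *)
Lemma trace_commutator_expg g h m n :
  \tr (commutator (g ^+ m.+1)%g (h ^+ n.+1)%g) - 2 =
  (chebyshevS K m.+1).[\tr g] ^+ 2 * (chebyshevS K n.+1).[\tr h] ^+ 2 *
    (\tr (commutator g h) - 2).
Proof.
apply: oppr_inj; rewrite -mulrN !opprB -!det_bracket_SL2 !expg_chebyshevS.
set x := _.[_]; set y := _.[_]; set z := _.[_]; set t := _.[_].
by rewrite !(mx22E, mxE) ?mulr1n ?mulr0n; ring.
Qed.

End Generators.

(** * The criterion for the group generated by the roots [R] and [S] *)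

Theorem theorem1p2 (K : realType) (A B : PSL2 K)
    (AB_Fuchsian : Fuchsian (generated [set A; B]))
    (AB_free : free_of_rank 2 (generated [set A; B]))
    (m n : nat) (m_gt0 : (0 < m)%N) (n_gt0 : (0 < n)%N)
    (R S : PSL2 K) (RA : (R ^+ m)%g = A) (SB : (S ^+ n)%g = B)
    (x y z : K) (xyz : (x, y, z) = trace_triple R S) :
  is_discrete (generated [set R; S]) /\ free_of_rank 2 (generated [set R; S])
  <->
  (commutator_trace A B <= -2 /\
   (chebyshevS K m).[x] ^+ 2 * (chebyshevS K n).[y] ^+ 2
     <= 1 / 2 - 1 / 4 * commutator_trace A B)
  \/
  (2 < commutator_trace A B /\
   exists x' y' z' : K,
     [/\ tma (x, y, z) (x', y', z'), 2 <= x', 2 <= y' & z' <= -2]).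
Proof.
pose g := nnlift R; pose h := nnlift S.
have [RE SE] : R = \pi_(PSL2 K) g /\ S = \pi_(PSL2 K) h by rewrite !nnliftK.
have AE : A = \pi_(PSL2 K) (g ^+ m)%g by rewrite piX -RE.
have BE : B = \pi_(PSL2 K) (h ^+ n)%g by rewrite piX -SE.
rewrite /trace_triple -/g -/h in xyz; case: xyz => xE yE zE.
have Qxyz : realizes (generated [set R; S]) (x, y, z).
  by exists g, h; rewrite RE SE xE yE zE.
have closed := realizes_move_closed (generated [set R; S]).
pose T := \tr (commutator g h).
have tauT : tau (x, y, z) = T by rewrite /T trace_commutator xE yE zE.
pose s := (chebyshevS K m).[x] ^+ 2 * (chebyshevS K n).[y] ^+ 2.
have trAB : commutator_trace A B - 2 = s * (T - 2).
  rewrite (trace_commutator_lift AE BE) /s xE yE.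
  by case: m n m_gt0 n_gt0 {AE BE RA SB s} => [//|m] [//|n] _ _;
    rewrite trace_commutator_expg.
have AB_ne2 : commutator_trace A B <> 2.
  case: AB_Fuchsian => _ _ nel AB2; apply: nel; rewrite AE BE.
  by apply: trace2_elementary; rewrite -(trace_commutator_lift AE BE).
have s_gt0 : 0 < s.
  rewrite lt_neqAle mulr_ge0 ?sqr_ge0 // andbT eq_sym.
  by apply/eqP => s0; apply: AB_ne2; move: trAB; rewrite s0 mul0r; lra.
have sRS := generated_subgroup [set R; S].
split=> [[dRS fRS]|[[AB2]|[_ [x' [y' [z' [tmaE x'2 y'2 z'2]]]]]]]; last first.
- have [p [q [-> [x'E y'E z'E]]]] := tma_move_closed closed tmaE Qxyz.
  by apply: pants_discrete_free; rewrite -?x'E -?y'E -?z'E.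
- rewrite -/s => sAB; rewrite RE SE; apply: torus_discrete_free; rewrite -/T.
  (* Substituting [trAB] into the bound on [s] gives [4 s <= - s (T - 2)]. *)
  have : s * (2 + T) <= 0 by lra.
  by rewrite pmulr_rle0 // -lerBrDl sub0r.
have trace_ge2 k : generated [set R; S] (\pi_(PSL2 K) k) -> 2 <= `|\tr k|.
  exact: discrete_free_trace.
have comm_mem p q : generated [set R; S] p -> generated [set R; S] q ->
    generated [set R; S] (commutator p q).
  by have [_ HM HV] := sRS; move=> Hp Hq;
    exact: (HM _ _ (HM _ _ (HM _ _ Hp Hq) (HV _ Hp)) (HV _ Hq)).
have R_mem : generated [set R; S] R by exact: generated_mem1.
have S_mem : generated [set R; S] S by exact: generated_mem2.
have T_ge2 : 2 <= `|T|.
  by apply: trace_ge2; rewrite pi_comm -RE -SE; exact: comm_mem.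
have AB_ge2 : 2 <= `|commutator_trace A B|.
  rewrite (trace_commutator_lift AE BE); apply: trace_ge2.
  by rewrite pi_comm !piX -RE -SE; apply: comm_mem;
    [exact: (subgroup_expg m sRS R_mem)|exact: (subgroup_expg n sRS S_mem)].
have [T2|T2] := ltrP 2 T; last first.
  have T_le : T <= -2.
    have T_ne2 : T != 2.
      by apply/eqP => T2'; apply: AB_ne2; move: trAB; rewrite T2' subrr mulr0; lra.
    move: T_ge2; rewrite ler_normr => /orP[T2'|]; last by lra.
    by case/negP: T_ne2; rewrite eq_le T2 T2'.
  have sT : s * (T + 2) <= 0 by rewrite pmulr_rle0 //; lra.
  left; rewrite -/s; split; last by lra.
  by move: AB_ge2; rewrite ler_normr => /orP[]; lra.
right; split.
  by rewrite -subr_gt0 trAB mulr_gt0 // subr_gt0.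
(* With [d <= 1] one has [d^2 <= d <= T - 2], so no square root is needed for the step size. *)
pose d := Num.min 1 (T - 2).
have d0 : 0 < d by rewrite lt_min ltr01 subr_gt0.
have dT : d ^+ 2 <= T - 2.
  apply: (@le_trans _ _ d); last by rewrite ge_min lexx orbT.
  by rewrite expr2 ger_pMl // ge_min lexx.
apply: (tma_terminates closed T2 d0 dT _ Qxyz tauT) => a b c.
move=> [p [q [HE [_ _ ->]]]]; apply: (trace_ge2 (p * q)%g); rewrite HE piM.
have [_ HM _] := generated_subgroup [set \pi_(PSL2 K) p; \pi_(PSL2 K) q].
by apply: HM; [exact: generated_mem1|exact: generated_mem2].
Qed.
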